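(* Let $F$ be a real Banach space, let $X$ be a symmetric random vector with values in $F$, and let $X_1,X_2,\ldots$ be independent copies of $X$. Suppose that there exist constants $0<K<\infty$ and $\alpha,\beta>0$ such that for all $n=1,2,\ldots$: (i) the random vector $(X_1,\ldots,X_n)$ with values in $l^n_{\infty}(F)$ is $K$-regular; (ii) $\mathbf{P}\big(\max_{i\leq n}\|X_i\|\geq \alpha\, \mathbf{E}\max_{i\leq n}\|X_i\|\big)\geq \beta$. Then for any random vector $Y$ with values in $F$ such that $Y\prec_{\omega} X$ and for every $t>0$ we have \[ \mathbf{P}(\|Y\|\geq t)\leq \frac{2}{\beta}\,\mathbf{P}\Big(\|X\|\geq \frac{\alpha t}{80 K}\Big). \]
   Context: A random vector with values in a Banach space is understood in the standard sense of a strongly measurable map (Borel measurable and almost surely taking values in a separable subspace) from a probability space into that Banach space. A random vector $X$ is symmetric if $X$ and $-X$ have the same distribution. $G^*$ denotes the dual of a Banach space $G$. $l^n_\infty(F)$ is the space $F^n$ with the norm $\|(v_1,\ldots,v_n)\|=\max_{i\leq n}\|v_i\|$. Weak tail domination: for random vectors $X$ and $Y$ with values in $F$, $Y\prec_{\omega}X$ means \[ \mathbf{P}(|x^{*}(Y)|\geq t)\leq \mathbf{P}(|x^*(X)|\geq t)\quad\text{for all } x^*\in F^*,\ t>0. \] $K$-regularity: a random vector $Z$ with values in a Banach space $G$ is $K$-regular if there exists a sequence $(x_n^* )_{n\ge 1}\subset G^*$ such that \[ \|x_n^*(Z)\|_{\log(n+2)}:=\big(\mathbf{E}|x_n^*(Z)|^{\log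 (n+2)}\big)^{1/\log(n+2)}\leq K\,\mathbf{E}\|Z\|\quad\text{for } n=1,2,\ldots \] (where $\log$ is the natural logarithm) and \[ B_{G^*}=\{x^*\in G^*\colon \|x^*\|\leq 1\}\subset \mathrm{cl}_{Z}\big(\mathrm{conv}\{\pm x_n^*\colon n\geq 1\}\big), \] where, for $A\subset G^*$, $\mathrm{cl}_Z(A)$ denotes the closure of $A$ with respect to the $L^2$ distance $d_Z(x^*,y^* ):=(\mathbf{E}|x^*(Z)-y^*(Z)|^2)^{1/2}$. *)

(* Defs.v *)
From HB Require Import structures.
From mathcomp Require Import all_boot all_order all_algebra finmap.
From mathcomp Require Import all_classical all_reals all_analysis.

Set Implicit Arguments.
Unset Strict Implicit.
Unset Printing Implicit Defensive.

Import Order.TTheory GRing.Theory Num.Theory.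
Import numFieldNormedType.Exports.

Local Open Scope classical_set_scope.
Local Open Scope ring_scope.

Definition linfty (R : realType) (F : normedModType R) (n : nat) : Type :=
  {ffun 'I_n -> F}.

Section linfty_normed.
Context {R : realType} {F : normedModType R} {n : nat}.
Local Notation V := (linfty F n).

HB.instance Definition _ := GRing.Lmodule.on V.

Definition linfty_norm (v : V) : R := \big[Num.max/0]_(i < n) `|v i|.

Lemma linfty_norm_le (v : V) (r : R) :
  0 <= r -> (forall i, `|v i| <= r) -> linfty_norm v <= r.
Proof. by move=> r0 vr; apply/bigmax_leP; split => // i _; exact: vr. Qed.

Lemma le_linfty_norm (v : V) i : `|v i| <= linfty_norm v.
Proof. exact: (le_bigmax _ (fun i => `|v i|)). Qed.

Lemma linfty_norm_ge0 (v : V) : 0 <= linfty_norm v.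
Proof. exact: bigmax_ge_id. Qed.

Let ler_normD (x y : V) : linfty_norm (x + y) <= linfty_norm x + linfty_norm y.
Proof.
apply: linfty_norm_le => [|i]; first by rewrite addr_ge0 ?linfty_norm_ge0.
by rewrite ffunE (le_trans (ler_normD _ _))// lerD// le_linfty_norm.
Qed.

Let normrZ (l : R) (x : V) : linfty_norm (l *: x) = `|l| * linfty_norm x.
Proof.
have le1 k (y : V) : linfty_norm (k *: y) <= `|k| * linfty_norm y.
  apply: linfty_norm_le => [|i]; first by rewrite mulr_ge0 ?linfty_norm_ge0.
  by rewrite ffunE normrZ ler_wpM2l// le_linfty_norm.
apply/eqP; rewrite eq_le le1/=; have [->|l0] := eqVneq l 0.
  by rewrite normr0 mul0r linfty_norm_ge0.
rewrite -ler_pdivlMl ?normr_gt0//.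
by have := le1 l^-1 (l *: x); rewrite scalerA mulVf// scale1r normfV.
Qed.

Let normr0_eq0 (x : V) : linfty_norm x = 0 -> x = 0.
Proof.
move=> x0; apply/ffunP => i; rewrite ffunE; apply/eqP.
by rewrite -normr_le0 -x0 le_linfty_norm.
Qed.

HB.instance Definition _ :=
  Lmodule_isNormed.Build R V ler_normD normrZ normr0_eq0.

End linfty_normed.

Section linfty_complete.
Context {R : realType} {F : completeNormedModType R} {n : nat}.
Local Notation V := (linfty F n).

Let linfty_cauchy_cvg (G : set_system V) :
  ProperFilter G -> cauchy G -> cvg G.
Proof.
move=> PG /cauchyP cG.
have cvgi (i : 'I_n) : cvg ((fun v : V => v i) @ G).
  apply/cauchy_cvgP/cauchyP => e e0.
  have [x Gx] := cG e e0; exists ((x : V) i).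
  have ballE (v : V) : ball x e v -> ball ((x : V) i) e (v i).
    rewrite -!ball_normE /ball_/=; apply: le_lt_trans.
    by have := le_linfty_norm ((x : V) - v) i; rewrite !ffunE.
  exact: filterS ballE Gx.
pose a : V := [ffun i => lim ((fun v : V => v i) @ G)].
apply/cvg_ex; exists a; apply/cvgrPdist_le => e e0.
have : \forall v \near G, forall i, `|a i - (v : V) i| <= e.
  apply: filter_forall => i; have /cvgrPdist_le := cvgi i; move/(_ e e0).
  by rewrite /a ffunE.
apply: filterS => v va; apply: linfty_norm_le => [|i]; first exact: ltW.
by have := va i; rewrite !ffunE.
Qed.

HB.instance Definition _ := Uniform_isComplete.Build V linfty_cauchy_cvg.

End linfty_complete.

Section random_vectors.
Context {R : realType} {F : normedModType R}.

Definition linear_subspace (S : set F) : Prop :=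
  S 0 /\ forall (a : R) x y, S x -> S y -> S (a *: x + y).

Definition separable_set (S : set F) : Prop :=
  exists D : set F, [/\ countable D, D `<=` S & S `<=` closure D].

(* [g_sigma_algebraType (@open F)] is [F] with its Borel sigma-algebra. *)
Definition random_vector d (T : measurableType d) (P : probability T R)
    (X : T -> F) : Prop :=
  measurable_fun [set: T] (X : T -> g_sigma_algebraType (@open F)) /\
  exists S : set F, [/\ linear_subspace S, separable_set S &
    {ae P, forall w, S (X w)}].

Definition same_distribution d (T : measurableType d) (P : probability T R)
    d' (T' : measurableType d') (Q : probability T' R)
    (X : T -> F) (Y : T' -> F) : Prop :=
  forall A : set (g_sigma_algebraType (@open F)),
    measurable A -> P (X @^-1` A) = Q (Y @^-1` A).

Definition symmetric_vector d (T : measurableType d) (P : probability T R)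
    (X : T -> F) : Prop :=
  same_distribution P P X (fun w => - X w).

Definition mutually_independent d (T : measurableType d) (P : probability T R)
    (X : nat -> T -> F) : Prop :=
  forall (J : {fset nat}) (A : nat -> set (g_sigma_algebraType (@open F))),
    (forall i, i \in J -> measurable (A i)) ->
    P (\bigcap_(i in [set` J]) (X i @^-1` A i)) =
    (\prod_(i <- J) P (X i @^-1` A i))%E.

Definition independent_copies d (T : measurableType d) (P : probability T R)
    d' (T' : measurableType d') (Q : probability T' R)
    (X : T -> F) (Xs : nat -> T' -> F) : Prop :=
  [/\ forall i, random_vector Q (Xs i),
      forall i, same_distribution Q P (Xs i) X &
      mutually_independent Q Xs].

End random_vectors.

Section functionals.
Context {R : realType} {G : normedModType R}.

Definition dual_space : set (G -> R^o) := [set f | linear f /\ continuous f].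

Definition dual_norm (f : G -> R^o) : R :=
  sup [set `|f v| | v in [set v : G | `|v| <= 1]].

Definition dual_ball : set (G -> R^o) := [set f | dual_space f /\ dual_norm f <= 1].

Definition convex_hull (A : set (G -> R^o)) : set (G -> R^o) :=
  [set f | exists (m : nat) (a : 'I_m -> R) (g : 'I_m -> G -> R^o),
    [/\ forall i, 0 <= a i, \sum_(i < m) a i = 1, forall i, A (g i) &
        f = fun v => \sum_(i < m) a i * g i v]].

Context d (T : measurableType d) (P : probability T R).

(* [+oo] when the difference is not square integrable. *)
Definition L2_dist (Z : T -> G) (f g : G -> R^o) : \bar R :=
  'N[P]_2%:E [(fun w => (f (Z w) - g (Z w))%:E)]%E.

Definition L2_closure (Z : T -> G) (A : set (G -> R^o)) : set (G -> R^o) :=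
  [set f | dual_space f /\
    forall e : R, 0 < e -> exists2 g, A g & (L2_dist Z f g < e%:E)%E].

End functionals.

(* Expectations and L^p norms are extended real-valued, so integrability of
   [`|Z|] is not presupposed; neither is strong measurability of [Z].
   Only the terms [x n] with [0 < n] matter. *)
Definition K_regular (R : realType) (G : completeNormedModType R)
    d (T : measurableType d) (P : probability T R) (K : R) (Z : T -> G) : Prop :=
  exists x : nat -> G -> R^o,
    [/\ forall n, (0 < n)%N -> dual_space (x n),
        forall n, (0 < n)%N ->
          ('N[P]_(ln (n + 2)%:R)%:E [(fun w => (x n (Z w))%:E)]
            <= K%:E * 'E_P[fun w => `|Z w|%R])%E &
        dual_ball `<=` L2_closure P Z (convex_hull
          [set f | exists2 n, (0 < n)%N &
            f = x n \/ f = (fun v => - x n v)])].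

Definition weak_tail_dominated (R : realType) (F : normedModType R)
    d (T : measurableType d) (P : probability T R)
    d' (T' : measurableType d') (Q : probability T' R)
    (Y : T -> F) (X : T' -> F) : Prop :=
  forall (f : F -> R^o) (t : R), dual_space f -> 0 < t ->
    (P [set w | (t <= `|f (Y w)|)%R] <= Q [set w | (t <= `|f (X w)|)%R])%E.

(* [Xs 0], ..., [Xs n.-1] stand for X_1, ..., X_n. *)
Definition first_vectors (R : realType) (F : normedModType R) (T : Type)
    (Xs : nat -> T -> F) (n : nat) (w : T) : linfty F n :=
  [ffun i : 'I_n => Xs i w].

(* Main.v *)
(* Let [M_n = E max_(i < n) `|X_i|].  Replace [Y] by a random sign times [Y]
   (this changes neither [`|Y|] nor [`|f Y|]) and take [n] independent copies
   [Y_i].  For a functional [g] on l_infty^n(F), [g (X_1, ..., X_n)] is a sum of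
   independent symmetric variables [g_i X_i], and replacing [g_i X_i] by
   [g_i Y_i] one at a time only decreases [E `|a + sum|^p], because
   [s |-> `|a + s|^p + `|a - s|^p] is even and increasing in [`|s|].  So the
   functionals [x_m] given by K-regularity satisfy
   [E `|x_m (Y_1, ..., Y_n)|^p <= (K M_n)^p] with [p = ln (m + 2)], and Markov's
   inequality with a union bound gives
   [P (sup_m `|x_m (Y_1, ..., Y_n)| >= s) <= \sum_m 80^-(ln (m + 2)) <= 1 / 6]
   for [s >= 80 K M_n].  The closure condition, transferred from [X] to [Y] by
   the comparison with [p = 2] and applied to countably many norming
   functionals, identifies the supremum with [max_i `|Y_i|].
   With [q = P (`|Y| >= t)] and [1 <= n q <= 2], however,
   [P (max_i `|Y_i| >= t) = 1 - (1 - q)^n >= 1 / 2]; hence [t <= 80 K M_n], and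
   (ii) yields [beta <= n P (`|X| >= alpha t / (80 K))]. *)

Require Import Defs.
From HB Require Import structures.
From mathcomp Require Import all_boot all_order all_algebra finmap.
From mathcomp Require Import all_classical all_reals all_analysis.
From mathcomp Require Import measurable_realfun ring lra.

Set Implicit Arguments.
Unset Strict Implicit.
Unset Printing Implicit Defensive.

Import Order.TTheory GRing.Theory Num.Theory.
Import numFieldNormedType.Exports.

Local Open Scope classical_set_scope.
Local Open Scope ring_scope.

(** * Norming functionals *)

Section hahn_banach.
Context {R : realType} {V : lmodType R}.

(** Positive homogeneity is asked only as an inequality, which is easier to check for infima; using
    it for both [a] and [a^-1] gives equality. *)
Definition sublinear (q : V -> R) :=
  (forall x y, q (x + y) <= q x + q y) /\
  (forall a x, 0 < a -> q (a *: x) <= a * q x).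

Lemma sublinear0 q : sublinear q -> q 0 = 0.
Proof.
move=> [_ qZ]; apply/eqP; rewrite eq_le.
have := qZ 2 0 ltac:(lra); have := qZ (2^-1) 0; rewrite !scaler0.
by move=> /(_ ltac:(lra)) ? ?; apply/andP; split; lra.
Qed.

Lemma sublinearN q x : sublinear q -> - q (- x) <= q x.
Proof.
move=> sq; have [qD _] := sq; have := qD x (- x).
by rewrite subrr sublinear0//; lra.
Qed.

(** A sublinear functional below [q] whose value at [- z] is at most [- q z] (take [t = 1]). A
    linear functional below it therefore takes at [z] a value at least [q z]. *)
Definition sublinear_shift (q : V -> R) (z x : V) : R :=
  inf [set q (x + t *: z) - t * q z | t in [set t | 0 <= t]].

Lemma sublinear_shift_le q z x t : sublinear q -> 0 <= t ->
  sublinear_shift q z x <= q (x + t *: z) - t * q z.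
Proof.
move=> sq t0; apply: ge_inf; last by exists t.
(* The set is bounded below since [s * q z <= q (s *: z) <= q (x + s *: z) + q (- x)]. *)
exists (- q (- x)) => _ [s /= s0 <-].
have [->|s_neq0] := eqVneq s 0.
  by rewrite scale0r addr0 mul0r subr0; exact: sublinearN.
have s_gt0 : 0 < s by rewrite lt0r s_neq0.
have [qD qZ] := sq; have := qD (x + s *: z) (- x).
rewrite addrAC subrr add0r.
have := qZ s^-1 (s *: z); rewrite scalerA mulVf// scale1r invr_gt0.
move=> /(_ s_gt0); rewrite ler_pdivlMl//; lra.
Qed.

(** Parameters [t] at [x] and [s] at [y] are compared with [t + s] at [x + y], and [t] at [x] with
    [a * t] at [a *: x]. *)
Lemma sublinear_shift_sublinear q z : sublinear q ->
  sublinear (sublinear_shift q z).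
Proof.
move=> sq; have [qD qZ] := sq.
have ne x : [set q (x + t *: z) - t * q z | t in [set t | 0 <= t]] !=set0.
  by exists (q (x + 0 *: z) - 0 * q z), 0 => /=.
split=> [x y|a x a0].
  rewrite -lerBlDr; apply: lb_le_inf => // _ [t /= t0 <-].
  rewrite lerBlDr -lerBlDl; apply: lb_le_inf => // _ [s /= s0 <-].
  have := sublinear_shift_le z (x + y) sq (addr_ge0 t0 s0).
  have := qD (x + t *: z) (y + s *: z).
  by rewrite addrACA -scalerDl; lra.
rewrite -ler_pdivrMl//; apply: lb_le_inf => // _ [t /= t0 <-].
rewrite ler_pdivrMl//.
have := sublinear_shift_le z (a *: x) sq (mulr_ge0 (ltW a0) t0).
have := qZ a (x + t *: z) a0.
by rewrite scalerDr scalerA; lra.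
Qed.

(* Minimal sublinear functionals are linear: [sublinear_shift q z <= q] forces
   [q x + q z <= q (x + z)] when [q] is minimal. *)
Lemma hahn_banach p : sublinear p -> exists2 f : V -> R^o,
  linear f & forall x, f x <= p x.
Proof.
move=> sp.
pose T := {q : V -> R | sublinear q /\ forall x, q x <= p x}.
(* The order is reversed, so that a maximal element in Zorn's lemma is a pointwise minimal
   functional. *)
pose r (f g : T) := `[< forall x, sval g x <= sval f x >].
have [|||A Atot|[q [sq qp]] qmin] := @Zorn T r.
- by move=> f; apply/asboolP.
- move=> f g h /asboolP fg /asboolP gh; apply/asboolP => x.
  exact: le_trans (gh x) (fg x).
- move=> [f pf] [g pg] /asboolP /= fg /asboolP /= gf; apply: eq_exist => /=.
  by apply/funext => x; apply/eqP; rewrite eq_le fg gf.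
- have [A0|/set0P/negP/negPn/eqP ->] := pselect (A !=set0); last first.
    have pp : sublinear p /\ forall x, p x <= p x by [].
    by exists (exist _ p pp).
  have [f0 Af0] := A0.
  pose q x := inf [set sval f x | f in A].
  have ne x : [set sval f x | f in A] !=set0 by exists (sval f0 x), f0.
  have qle x f : A f -> q x <= sval f x.
    move=> Af; apply: ge_inf; last by exists f.
    exists (- p (- x)) => _ [[g [sg gp]] _ <-] /=.
    by apply: le_trans (sublinearN x sg); rewrite lerN2.
  (* The pointwise infimum of a chain is subadditive: of two members [f] and [g], the smaller one
     bounds [q (x + y)] by [f x + g y]. *)
  have sq : sublinear q.
    split=> [x y|a x a0].
      rewrite -lerBlDr; apply: lb_le_inf => // _ [f Af <-].
      rewrite lerBlDr -lerBlDl; apply: lb_le_inf => // _ [g Ag <-].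
      rewrite lerBlDl; have [/asboolP fg|/asboolP gf] := Atot f g Af Ag.
        have [[gD _] _] := svalP g.
        apply: le_trans (qle _ _ Ag) _; apply: le_trans (gD x y) _.
        by rewrite lerD2r.
      have [[fD _] _] := svalP f.
      apply: le_trans (qle _ _ Af) _; apply: le_trans (fD x y) _.
      by rewrite lerD2l.
    rewrite -ler_pdivrMl//; apply: lb_le_inf => // _ [f Af <-].
    rewrite ler_pdivrMl//; have [[_ fZ] _] := svalP f.
    exact: le_trans (qle _ _ Af) (fZ _ _ a0).
  have qp x : q x <= p x.
    by apply: le_trans (qle _ _ Af0) _; have [_] := svalP f0.
  by exists (exist _ q (conj sq qp)) => f Af; apply/asboolP => x; exact: qle.
have qshift z x : q x <= q (x + z) - q z.
  have shiftq y : sublinear_shift q z y <= q y.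
    have := sublinear_shift_le z y sq (lexx 0).
    by rewrite scale0r addr0 mul0r subr0.
  have pf : sublinear (sublinear_shift q z) /\
      forall y, sublinear_shift q z y <= p y.
    by split=> [|y]; [exact: sublinear_shift_sublinear|exact: le_trans (qp y)].
  have /(congr1 sval)/= qE := qmin (exist _ _ pf) ltac:(exact/asboolP).
  rewrite -[in leLHS]qE.
  by have := sublinear_shift_le z x sq ler01; rewrite scale1r mul1r.
have [qD qZ] := sq.
have qDE x z : q (x + z) = q x + q z.
  by apply/eqP; rewrite eq_le qD; have := qshift z x; lra.
have qNE x : q (- x) = - q x.
  by have := qDE x (- x); rewrite subrr sublinear0//; lra.
have qZp a x : 0 < a -> q (a *: x) = a * q x.
  move=> a0; apply/eqP; rewrite eq_le qZ//=.
  by have := qZ a (- x) a0; rewrite scalerN !qNE; lra.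
exists q => // a x y; rewrite qDE; congr (_ + _).
change (q (a *: x) = a * q x).
have [a0|a0|->] := ltgtP a 0; last by rewrite scale0r mul0r sublinear0.
- by rewrite -[in LHS](opprK a) scaleNr qNE qZp ?oppr_gt0// mulNr opprK.
- exact: qZp.
Qed.

End hahn_banach.

Lemma linear_fun_sub {R : realType} {V : lmodType R} (f : V -> R^o) u v :
  linear f -> f (u - v) = f u - f v.
Proof.
move=> lf; pose f' : {linear V -> R^o} :=
  HB.pack f (GRing.isLinear.Build _ _ _ _ f lf).
exact: (linearB f').
Qed.

Lemma linear_fun_opp {R : realType} {V : lmodType R} (f : V -> R^o) v :
  linear f -> f (- v) = - f v.
Proof.
move=> lf; pose f' : {linear V -> R^o} :=
  HB.pack f (GRing.isLinear.Build _ _ _ _ f lf).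
exact: (linearN f').
Qed.

(** Hahn-Banach is applied to the norm shifted at [z]: the resulting [f] lies below the norm and
    satisfies [f (- z) <= -]|z|[, hence]f z >= [|z|]. *)
Lemma norming_functional {R : realType} {V : normedModType R} (z : V) :
  exists f : V -> R^o, [/\ linear f, forall x, `|f x| <= `|x| & f z = `|z|].
Proof.
have sn : sublinear (fun x : V => `|x|).
  split=> [x y|a x a0]; first exact: ler_normD.
  by rewrite normrZ gtr0_norm.
have [f lf fle] := hahn_banach (sublinear_shift_sublinear z sn).
have fN x : f (- x) = - f x by exact: linear_fun_opp.
have fn x : f x <= `|x|.
  apply: le_trans (fle x) _; have := sublinear_shift_le z x sn (lexx 0).
  by rewrite scale0r addr0 mul0r subr0.
have fabs x : `|f x| <= `|x|.
  by rewrite ler_norml fn andbT lerNl -fN -[leRHS]normrN fn.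
exists f; split => //; apply/eqP; rewrite eq_le fn/= -lerN2 -fN.
apply: le_trans (fle _) _; have := sublinear_shift_le z (- z) sn ler01.
by rewrite scale1r addNr normr0 mul1r sub0r.
Qed.

Lemma bounded_dual_space {R : realType} {V : normedModType R} (f : V -> R^o) :
  linear f -> (forall x, `|f x| <= `|x|) -> dual_space f.
Proof.
move=> lf fb; split => //.
move=> x; apply/cvgrPdist_le => e e0; near=> y.
rewrite -linear_fun_sub//; apply: le_trans (fb _) _.
near: y; exact: cvgr_dist_le.
Unshelve. all: by end_near. Qed.

Section dual_space.
Context {R : realType} {V : normedModType R}.

Lemma dual_spaceN (f : V -> R^o) : dual_space f -> dual_space (fun v => - f v).
Proof.
move=> [lf cf]; split=> [a u v|v]; first by rewrite lf opprD scalerN.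
by apply: cvgN; exact: cf.
Qed.

Lemma dual_spaceB (f g : V -> R^o) : dual_space f -> dual_space g ->
  dual_space (fun v => f v - g v).
Proof.
move=> [lf cf] [lg cg]; split => [a u v|v].
  by rewrite lf lg scalerBr opprD addrACA.
by apply: cvgB; [exact: cf|exact: cg].
Qed.

Lemma convex_hull_norm_le (A : set (V -> R^o)) g v (t : R) :
  convex_hull A g -> (forall f, A f -> `|f v| <= t) -> `|g v| <= t.
Proof.
move=> [m [a [h [a0 a1 Ah ->]]]] At.
apply: le_trans (ler_norm_sum _ _ _) _.
rewrite -[t]mul1r -a1 mulr_suml; apply: ler_sum => i _.
by rewrite normrM ger0_norm// ler_wpM2l// At.
Qed.

Lemma convex_hull_dual_space (A : set (V -> R^o)) g :
  (forall f, A f -> dual_space f) -> convex_hull A g -> dual_space g.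
Proof.
move=> Ad [m [a [h [_ _ Ah ->]]]]; split.
  move=> b u v; rewrite scaler_sumr -big_split/=; apply: eq_bigr => i _.
  by rewrite (Ad _ (Ah i)).1 mulrDr; congr (_ + _); rewrite mulrCA.
apply: (@continuous_big R^o _ _ _ xpredT (@add_continuous _)) => i _ v.
by apply: cvgMl_tmp; exact: (Ad _ (Ah i)).2.
Qed.

End dual_space.

(** * Independence *)

Section independence.
Context {R : realType}.

(** Measurable rectangles are stable under intersection and generate the product sigma-algebra, so
    they determine a finite measure. *)
Lemma eq_measure_rectangles d1 d2 (T1 : measurableType d1)
    (T2 : measurableType d2) (m m' : {measure set (T1 * T2) -> \bar R}) :
  (m [set: T1 * T2] < +oo)%E ->
  (forall A B, measurable A -> measurable B -> m (A `*` B) = m' (A `*` B)) ->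
  forall C, measurable C -> m C = m' C.
Proof.
move=> moo mm' C mC.
apply: (@measure_unique _ R (T1 * T2)%type
  [set A `*` B | A in measurable & B in measurable] (fun=> setT)) => //.
- by rewrite measurable_prod_measurableType.
- move=> _ _ [A mA [B mB <-]] [A' mA' [B' mB' <-]]; rewrite -setXI.
  exists (A `&` A'); first exact: measurableI.
  by exists (B `&` B') => //; exact: measurableI.
- by move=> _; exists setT => //; exists setT => //; rewrite setXTT.
- by rewrite bigcup_const.
- by move=> _ [A mA [B mB <-]]; exact: mm'.
Qed.

Section one_space.
Context d {T : measurableType d} (P : probability T R).

Definition independent_pair d1 d2 (T1 : measurableType d1)
    (T2 : measurableType d2) (u : T -> T1) (v : T -> T2) :=
  forall (A : set T1) (B : set T2), measurable A -> measurable B ->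
  P (u @^-1` A `&` v @^-1` B) = (P (u @^-1` A) * P (v @^-1` B))%E.

(** The joint law of an independent pair is the product of its marginals, and Tonelli's theorem
    applies. This allows one variable to be frozen while the other is replaced. *)
Lemma independent_pair_integral d1 d2 (T1 : measurableType d1)
    (T2 : measurableType d2) (u : T -> T1) (v : T -> T2)
    (f : T1 * T2 -> \bar R) :
  measurable_fun setT u -> measurable_fun setT v -> independent_pair u v ->
  measurable_fun setT f -> (forall z, 0 <= f z)%E ->
  (\int[P]_w f (u w, v w) = \int[P]_w' \int[P]_w f (u w, v w'))%E.
Proof.
move=> mu mv uv mf f0.
pose u' : {mfun T >-> T1} := HB.pack u (isMeasurableFun.Build _ _ _ _ u mu).
pose v' : {mfun T >-> T2} := HB.pack v (isMeasurableFun.Build _ _ _ _ v mv).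
have muv : measurable_fun setT (fun w => (u w, v w)).
  exact: measurable_fun_pair.
pose uv' : {mfun T >-> (T1 * T2)%type} :=
  HB.pack (fun w => (u w, v w)) (isMeasurableFun.Build _ _ _ _ _ muv).
transitivity (\int[distribution P uv']_z f z)%E.
  by rewrite ge0_integral_distribution.
transitivity (\int[(distribution P u' \x distribution P v')%E]_z f z)%E.
  apply: eq_measure_integral => A mA _; apply: eq_measure_rectangles => //.
    by rewrite /= probability_setT ltry.
  move=> B C mB mC; rewrite /= product_measure1E//.
  exact: uv.
rewrite fubini_tonelli2// ge0_integral_distribution//.
- apply: eq_integral => w' _ /=; rewrite /fubini_G ge0_integral_distribution//.
  exact: measurableT_comp.
- exact: measurable_fun_fubini_tonelli_G.
- by move=> y; apply: integral_ge0.
Qed.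

(** Only the full range of indices below [n] is tested; taking [A i] to be [setT] for the other
    indices recovers every subfamily. *)
Definition independent_upto d1 (T1 : measurableType d1) (n : nat)
    (x : nat -> T -> T1) :=
  forall A : nat -> set T1, (forall i, measurable (A i)) ->
    P (\big[setI/setT]_(i < n) (x i @^-1` A i)) =
    (\prod_(i < n) P (x i @^-1` A i))%E.

Lemma independent_upto2 d1 (T1 : measurableType d1) (x : nat -> T -> T1) :
  independent_upto 2 x -> independent_pair (x 0%N) (x 1%N).
Proof.
move=> ix A B mA mB; have := ix (fun i => if i == 0%N then A else B).
rewrite !big_ord_recl !big_ord0 setIT mule1; apply.
by move=> i; case: ifP.
Qed.

Lemma independent_upto_leq d1 (T1 : measurableType d1) m n
    (x : nat -> T -> T1) : (m <= n)%N ->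
  independent_upto n x -> independent_upto m x.
Proof.
move=> mn ix A mA.
pose A' i := if (i < m)%N then A i else setT.
have mA' i : measurable (A' i) by rewrite /A'; case: ifP.
have := ix A' mA'; rewrite -(subnKC mn) !big_split_ord /=.
rewrite [X in _ `&` X]big1 => [|i _]; last by rewrite /A' ltnNge leq_addr.
rewrite [X in (_ * X)%E]big1 => [|i _]; last first.
  by rewrite /A' ltnNge leq_addr/= preimage_setT probability_setT.
rewrite setIT mule1.
under eq_bigr do rewrite /A' ltn_ord.
by under [in RHS]eq_bigr do rewrite /A' ltn_ord.
Qed.

(** Merging the first two variables shortens a family by one and keeps its total sum, which allows
    induction on the number of summands. *)
Definition merge2 (x : nat -> T -> R) (i : nat) : T -> R :=
  if i is 0%N then x 0%N \+ x 1%N else x i.+1.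

Lemma measurable_merge2 x : (forall i, measurable_fun setT (x i)) ->
  forall i, measurable_fun setT (merge2 x i).
Proof.
by move=> mx [|i] /=; [exact: measurable_funD|exact: mx].
Qed.

(** Let [D] be the event fixed by the remaining variables. The law of the first two variables
    restricted to [D], and [P D] times their law, agree on rectangles, hence also on the set of
    pairs whose sum lies in [A 0]. *)
Lemma independent_upto_merge2 n (x : nat -> T -> R) :
  (forall i, measurable_fun setT (x i)) ->
  independent_upto n.+2 x -> independent_upto n.+1 (merge2 x).
Proof.
move=> mx ix A mA.
pose D := \big[setI/setT]_(i < n) (x i.+2 @^-1` A i.+1).
have mD : measurable D.
  apply: bigsetI_measurable => i _; rewrite -[X in measurable X]setTI.
  exact: mx.
have m01 : measurable_fun setT (fun w => (x 0%N w, x 1%N w)).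
  exact: measurable_fun_pair.
pose x01' : {mfun T >-> (R * R)%type} :=
  HB.pack (fun w => (x 0%N w, x 1%N w)) (isMeasurableFun.Build _ _ _ _ _ m01).
have r0 : 0 <= fine (P D) by rewrite fine_ge0.
pose m := pushforward (mrestr P mD) x01'.
pose m' := mscale (NngNum r0) (distribution P x01').
pose C : set (R * R) :=
  (fun z : R * R => z.1 + z.2) @^-1` A 0%N.
have mC : measurable C.
  rewrite -[X in measurable X]setTI.
  by apply: measurable_funD => //; exact: (mA 0%N).
have rect B1 B2 : measurable B1 -> measurable B2 ->
    P ((x 0%N @^-1` B1 `&` x 1%N @^-1` B2) `&` D) =
    (P (x 0%N @^-1` B1) * P (x 1%N @^-1` B2) *
      \prod_(i < n) P (x i.+2 @^-1` A i.+1))%E.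
  move=> mB1 mB2.
  have := ix (fun i => if i is k.+1 then if k is l.+1 then A l.+1 else B2 else B1).
  rewrite !big_ord_recl/= -/D setIA muleA; apply.
  by move=> [|[|i]].
have PD : P D = (\prod_(i < n) P (x i.+2 @^-1` A i.+1))%E.
  have := rect setT setT measurableT measurableT.
  by rewrite !preimage_setT !setTI probability_setT !mul1e.
have x01 := independent_upto2 (independent_upto_leq (isT : (2 <= n.+2)%N) ix).
have : m C = m' C.
  apply: eq_measure_rectangles => //.
    rewrite /m/= /pushforward /mrestr preimage_setT setTI.
    by rewrite (le_lt_trans (probability_le1 _ _))// ltry.
  move=> B1 B2 mB1 mB2.
  rewrite /m /m'/= /pushforward /mrestr /mscale /= fineK ?fin_num_measure//.
  rewrite [LHS](rect _ _ mB1 mB2) -PD muleC; congr (_ * _)%E.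
  by rewrite -x01.
rewrite /m /m'/= /pushforward /mrestr /mscale /= fineK ?fin_num_measure//.
rewrite PD muleC => mCE; rewrite !big_ord_recl/=.
exact: mCE.
Qed.

Lemma independent_upto_sum n (x : nat -> T -> R) :
  (forall i, measurable_fun setT (x i)) ->
  independent_upto n.+2 x ->
  independent_pair (fun w => \sum_(i < n.+1) x i w) (x n.+1).
Proof.
elim: n x => [|n IHn] x mx ix.
  have := independent_upto2 ix; congr independent_pair.
  by apply/funext => w; rewrite big_ord_recl big_ord0 addr0.
have := IHn _ (measurable_merge2 mx) (independent_upto_merge2 mx ix).
congr independent_pair; apply/funext => w.
by rewrite !big_ord_recl/= addrA.
Qed.

Lemma independent_upto_comp d1 (T1 : measurableType d1) d2
    (T2 : measurableType d2) n (x : nat -> T -> T1) (g : nat -> T1 -> T2) :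
  (forall i, measurable_fun setT (g i)) -> independent_upto n x ->
  independent_upto n (fun i => g i \o x i).
Proof.
move=> mg ix A mA; apply: (ix (fun i => g i @^-1` A i)) => i.
by rewrite -[X in measurable X]setTI; exact: mg.
Qed.

End one_space.
End independence.

(** * Moment comparison for sums of symmetric variables *)

Section moment_comparison.
Context {R : realType}.

Section one_variable.
Context d {T : measurableType d} (P : probability T R)
  d' {U : measurableType d'} (Q : probability U R).

Definition tail_dominated (y : U -> R) (x : T -> R) := forall t, 0 < t ->
  (Q [set v | (t <= `|y v|)%R] <= P [set w | (t <= `|x w|)%R])%E.

Definition symmetric_variable (x : T -> R) := forall A : set R, measurable A ->
  P (x @^-1` A) = P ((\- x) @^-1` A).

End one_variable.

Lemma symmetric_variable_integral d {T : measurableType d}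
    (P : probability T R) (x : T -> R) (f : R -> \bar R) :
  measurable_fun setT x -> symmetric_variable P x ->
  measurable_fun setT f -> (forall r, 0 <= f r)%E ->
  (\int[P]_w f (x w) = \int[P]_w f (- x w)%R)%E.
Proof.
move=> mx sx mf f0.
have mNx : measurable_fun setT (\- x) by exact: measurable_funN.
pose x' : {mfun T >-> R} := HB.pack x (isMeasurableFun.Build _ _ _ _ x mx).
pose Nx' : {mfun T >-> R} :=
  HB.pack (\- x) (isMeasurableFun.Build _ _ _ _ (\- x) mNx).
transitivity (\int[distribution P x']_r f r)%E.
  by rewrite ge0_integral_distribution.
transitivity (\int[distribution P Nx']_r f r)%E.
  by apply: eq_measure_integral => A mA _; exact: sx.
by rewrite ge0_integral_distribution.
Qed.

Section domination.
Context d {T : measurableType d} (P : probability T R)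
  d' {U : measurableType d'} (Q : probability U R).
Variables (x : T -> R) (y : U -> R).
Hypotheses (mx : measurable_fun setT x) (my : measurable_fun setT y).
Hypothesis yx : tail_dominated P Q y x.

Lemma measurable_ge_abs d0 (T0 : measurableType d0) (z : T0 -> R) t :
  measurable_fun setT z -> measurable [set w | t <= `|z w|].
Proof.
move=> mz; rewrite -[X in measurable X]setTI.
have := measurableT_comp (@normr_measurable R setT) mz.
move=> /(_ measurableT `[t, +oo[%classic) /=.
rewrite (_ : _ @^-1` _ = [set w | t <= `|z w|]); first by apply.
by apply/seteqP; split => w /=; rewrite in_itv/= andbT.
Qed.

Lemma measurable_gt_abs d0 (T0 : measurableType d0) (z : T0 -> R) t :
  measurable_fun setT z -> measurable [set w | t < `|z w|].
Proof.
move=> mz; rewrite -[X in measurable X]setTI.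
have := measurableT_comp (@normr_measurable R setT) mz.
move=> /(_ measurableT `]t, +oo[%classic) /=.
rewrite (_ : _ @^-1` _ = [set w | t < `|z w|]); first by apply.
by apply/seteqP; split => w /=; rewrite in_itv/= andbT.
Qed.

(** The strict tail is the increasing limit of the tails at [c + 1/(k+1)]. These thresholds are
    positive even for [c = 0], where domination is not assumed. *)
Lemma tail_dominated_gt c : 0 <= c ->
  (Q [set v | (c < `|y v|)%R] <= P [set w | (c < `|x w|)%R])%E.
Proof.
move=> c0; pose F (k : nat) := [set v | c + k.+1%:R^-1 <= `|y v|].
have mF k : measurable (F k) by exact: measurable_ge_abs.
have FE : \bigcup_k F k = [set v | c < `|y v|].
  apply/seteqP; split=> v /=.
    by move=> [k _] /=; apply: lt_le_trans; rewrite ltrDl.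
  move=> cy; have := cy; rewrite -subr_gt0 => cy'.
  have [k _ kP] := near_infty_natSinv_lt (PosNum cy').
  exists k => //; rewrite /F/= -lerBrDl ltW//.
  by have := kP k (leqnn k).
have Fcvg : Q (F k) @[k --> \oo] --> Q [set v | c < `|y v|].
  rewrite -FE; apply: nondecreasing_cvg_mu => //; first exact: bigcup_measurable.
  move=> m n mn; apply/subsetPset => v /=; apply: le_trans.
  by rewrite lerD2l lef_pV2 ?posrE// ler_nat.
rewrite -(cvg_lim _ Fcvg)//; apply: lime_le;
  first by apply/cvg_ex; eexists; exact: Fcvg.
apply: nearW => k; apply: (le_trans (yx _)); first exact: ltr_wpDl.
apply: le_measure; rewrite ?inE;
  [exact: measurable_ge_abs|exact: measurable_gt_abs|].
by move=> w /=; apply: lt_le_trans; rewrite ltrDl.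
Qed.

(** Layer-cake formula: both expectations are integrals of the probabilities that [g] exceeds [r].
    As [g] is even and increasing on the half-line, each such event says that the absolute value
    lies in a closed or open half-line starting at [inf E]. *)
Lemma tail_dominated_integral (g : R -> R) :
  measurable_fun setT g -> (forall r, 0 <= g r) ->
  (forall r, g r = g `|r|) ->
  (forall r s, 0 <= r -> r <= s -> g r <= g s) ->
  (\int[Q]_v (g (y v))%:E <= \int[P]_w (g (x w))%:E)%E.
Proof.
move=> mg g0 geven gmono.
have mgx : measurable_fun setT (g \o x) by exact: measurableT_comp.
have mgy : measurable_fun setT (g \o y) by exact: measurableT_comp.
pose X : {RV P >-> R} := HB.pack (g \o x) (isMeasurableFun.Build _ _ _ _ _ mgx).
pose Y : {RV Q >-> R} := HB.pack (g \o y) (isMeasurableFun.Build _ _ _ _ _ mgy).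
have EX : ('E_P[X] = \int[P]_w (g (x w))%:E)%E by rewrite unlock.
have EY : ('E_Q[Y] = \int[Q]_v (g (y v))%:E)%E by rewrite unlock.
rewrite -EX -EY !ge0_expectation_ccdf//; try by move=> w; exact: g0.
apply: ge0_le_integral => //; try exact: measurable_funTS (ccdf_measurable _).
move=> r _; rewrite /ccdf/= /distribution/= /pushforward/=.
pose E := [set s | 0 <= s /\ r < g s].
have preim d0 (T0 : measurableType d0) (z : T0 -> R) :
    (g \o z) @^-1` `]r, +oo[%classic = [set w | E `|z w|].
  apply/seteqP; split => w /=; rewrite /E/= in_itv/= andbT -geven.
    by move=> rg; split.
  by move=> [].
rewrite !preim.
have Eup s s' : E s -> s <= s' -> E s'.
  move=> [s0 rs] ss'; split; first exact: le_trans ss'.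
  exact: lt_le_trans rs (gmono _ _ s0 ss').
have [E0|/set0P/negP/negPn/eqP ->] := pselect (E !=set0); last first.
  by rewrite (_ : [set _ | _] = set0)// measure0.
have lbE : has_lbound E by exists 0 => s [].
have c0 : 0 <= inf E by apply: lb_le_inf => // s [].
have [Ec|nEc] := pselect (E (inf E)).
  have Eeq s : E s <-> inf E <= s.
    by split => [Es|]; [exact: ge_inf|exact: Eup].
  (* A closed half-line starting at 0 gives the sure event, which the domination at positive
     thresholds does not cover. *)
  have [c_eq0|c_neq0] := eqVneq (inf E) 0.
    rewrite (_ : [set w : T | _] = setT) ?probability_setT ?probability_le1//.
      rewrite [X in measurable X](_ : _ = [set v | inf E <= `|y v|]).
        exact: measurable_ge_abs.
      by apply/seteqP; split => v /= /Eeq.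
    by apply/seteqP; split => // w _; apply/Eeq; rewrite c_eq0.
  have := yx (_ : 0 < inf E); rewrite lt0r c_neq0 c0 => /(_ isT).
  by congr (Q _ <= P _)%E; apply/seteqP; split => w /= /Eeq.
have Eeq s : E s <-> inf E < s.
  split => [Es|cs].
    by rewrite lt_neqAle ge_inf// andbT; apply/eqP => sE; apply: nEc; rewrite sE.
  have s_gt : 0 < s - inf E by rewrite subr_gt0.
  have [s' Es'] := inf_adherent s_gt (conj E0 lbE).
  by rewrite subrKC => /ltW; exact: Eup.
have := tail_dominated_gt c0.
by congr (Q _ <= P _)%E; apply/seteqP; split => w /= /Eeq.
Qed.

End domination.

(** Both [a + r] and [a - r] are convex combinations of [a + s] and [a - s], with weights
    [t = (s + r) / (2 s)] and [1 - t] interchanged. Adding the two convexity inequalities for the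
    power [p] makes the weights sum to 1. *)
Lemma powR_abs_even_le (p a r s : R) : 1 <= p -> 0 <= r -> r <= s ->
  `|a + r| `^ p + `|a - r| `^ p <= `|a + s| `^ p + `|a - s| `^ p.
Proof.
move=> p1 r0 rs; have p0 : 0 <= p by exact: le_trans p1.
have [s0|s_neq0] := eqVneq s 0.
  by have -> : r = s by apply/eqP; rewrite eq_le rs s0 r0.
have s_gt0 : 0 < s by rewrite lt0r s_neq0 (le_trans r0).
pose t := (s + r) / (2 * s).
have t0 : 0 <= t by rewrite /t divr_ge0// ?addr_ge0// ?mulr_ge0// ltW.
have t1 : t <= 1 by rewrite /t ler_pdivrMr ?mulr_gt0// mul1r; lra.
have key u v : `|t * u + (1 - t) * v| `^ p <=
    t * `|u| `^ p + (1 - t) * `|v| `^ p.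
  apply: (@le_trans _ _ ((t * `|u| + (1 - t) * `|v|) `^ p)).
    apply: ge0_ler_powR; rewrite ?nnegrE ?normr_ge0//.
      by rewrite addr_ge0// mulr_ge0// subr_ge0.
    rewrite (le_trans (ler_normD _ _))// lerD// normrM ger0_norm//.
    by rewrite subr_ge0.
  by apply: (convex_powR p1 (Itv01 t0 t1)); rewrite inE/= in_itv/= andbT.
have -> : a + r = t * (a + s) + (1 - t) * (a - s).
  by rewrite /t; field.
have -> : a - r = t * (a - s) + (1 - t) * (a + s).
  by rewrite /t; field.
have := key (a + s) (a - s); have := key (a - s) (a + s); lra.
Qed.

Lemma measurable_powR_abs (p a : R) :
  measurable_fun setT (fun r : R => `|a + r| `^ p).
Proof.
apply: (measurableT_comp (measurable_powR p)).
apply: measurableT_comp => //; exact: measurable_funD.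
Qed.

Section one_step.
Context d {T : measurableType d} (P : probability T R)
  d' {U : measurableType d'} (Q : probability U R).

Lemma tail_dominated_moment (x : T -> R) (y : U -> R) (p a : R) : 1 <= p ->
  measurable_fun setT x -> measurable_fun setT y ->
  symmetric_variable P x -> symmetric_variable Q y -> tail_dominated P Q y x ->
  (\int[Q]_v (`|a + y v| `^ p)%:E <= \int[P]_w (`|a + x w| `^ p)%:E)%E.
Proof.
move=> p1 mx my sx sy yx.
pose g r := `|a + r| `^ p + `|a - r| `^ p.
have m1 := measurable_powR_abs p a.
have m2 : measurable_fun setT (fun r : R => `|a - r| `^ p).
  apply: (measurableT_comp m1); exact: measurable_funN.
have mg : measurable_fun setT g by exact: measurable_funD.
(* By symmetry, [a + z] and [a - z] have the same absolute moment, so passing to the even function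
   [g] just doubles it. *)
have dbl d0 (T0 : measurableType d0) (P0 : probability T0 R) (z : T0 -> R) :
    measurable_fun setT z -> symmetric_variable P0 z ->
    (\int[P0]_w (g (z w))%:E = 2%:E * \int[P0]_w (`|a + z w| `^ p)%:E)%E.
  move=> mz sz.
  have mz1 : measurable_fun setT (fun w => (`|a + z w| `^ p)%:E).
    by apply/measurable_EFinP; exact: (measurableT_comp m1).
  have mz2 : measurable_fun setT (fun w => (`|a - z w| `^ p)%:E).
    by apply/measurable_EFinP; exact: (measurableT_comp m2).
  under eq_integral do rewrite EFinD.
  rewrite (ge0_integralD P0 measurableT _ mz1 _ mz2); first last.
  - by move=> w; rewrite lee_fin powR_ge0.
  - by move=> w; rewrite lee_fin powR_ge0.
  rewrite -(symmetric_variable_integral mz sz (f := fun r => (`|a + r| `^ p)%:E)).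
  - by rewrite mule_natl mule2n.
  - exact/measurable_EFinP.
  - by move=> r; rewrite lee_fin powR_ge0.
have := tail_dominated_integral mx my yx mg.
rewrite !dbl// lee_pmul2l//; apply => //.
- by move=> r; rewrite addr_ge0 ?powR_ge0.
- move=> r; rewrite /g; have [r0|r0] := lerP 0 r; first by rewrite (ger0_norm r0).
  by rewrite (ltr0_norm r0) opprK addrC.
- by move=> r s r0 rs; exact: powR_abs_even_le.
Qed.

End one_step.

Section sums.
Context d {T : measurableType d} (P : probability T R)
  d' {U : measurableType d'} (Q : probability U R).
Variables (x : nat -> T -> R) (y : nat -> U -> R) (p : R).
Hypotheses (p1 : 1 <= p) (mx : forall i, measurable_fun setT (x i))
  (my : forall i, measurable_fun setT (y i))
  (sx : forall i, symmetric_variable P (x i))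
  (sy : forall i, symmetric_variable Q (y i))
  (yx : forall i, tail_dominated P Q (y i) (x i)).

Lemma tail_dominated_sum_moment n a :
  independent_upto P n x -> independent_upto Q n y ->
  (\int[Q]_v (`|a + \sum_(i < n) y i v| `^ p)%:E <=
   \int[P]_w (`|a + \sum_(i < n) x i w| `^ p)%:E)%E.
Proof.
case: n => [|n] ix iy.
  under eq_integral do rewrite big_ord0.
  under [leRHS]eq_integral do rewrite big_ord0.
  rewrite !integral_cst//.
  rewrite [X in (_ * X <= _)%E](_ : _ = 1%E); last exact: probability_setT.
  by rewrite [X in (_ <= _ * X)%E](_ : _ = 1%E)//; exact: probability_setT.
elim: n a ix iy => [|n IHn] a ix iy.
  under eq_integral do rewrite big_ord1.
  under [leRHS]eq_integral do rewrite big_ord1.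
  exact: tail_dominated_moment.
have mSx : measurable_fun setT (fun w => \sum_(i < n.+1) x i w).
  exact: measurable_sum.
have mSy : measurable_fun setT (fun w => \sum_(i < n.+1) y i w).
  exact: measurable_sum.
pose f (z : R * R) := (`|a + (z.1 + z.2)| `^ p)%:E.
have mf : measurable_fun setT f.
  apply/measurable_EFinP; apply: (measurableT_comp (measurable_powR_abs p a)).
  exact: measurable_funD.
have f0 z : (0 <= f z)%E by rewrite lee_fin powR_ge0.
have IHx := IHn _ (independent_upto_leq (leqnSn _) ix)
  (independent_upto_leq (leqnSn _) iy).
under eq_integral do rewrite big_ord_recr/=.
under [leRHS]eq_integral do rewrite big_ord_recr/=.
rewrite (independent_pair_integral mSx (mx _) (independent_upto_sum mx ix) mf f0).
rewrite (independent_pair_integral mSy (my _) (independent_upto_sum my iy) mf f0).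
have mfpair d1 (T1 : measurableType d1) d2 (T2 : measurableType d2)
    (u : T1 -> R) (v : T2 -> R) : measurable_fun setT u -> measurable_fun setT v ->
    measurable_fun setT (fun z : T1 * T2 => f (u z.1, v z.2)).
  move=> mu mv; apply: (measurableT_comp mf); apply: measurable_fun_pair.
    exact: (measurableT_comp mu measurable_fst).
  exact: (measurableT_comp mv measurable_snd).
have mxx := mfpair _ _ _ _ _ _ mSx (mx n.+1).
have myx := mfpair _ _ _ _ _ _ mSy (mx n.+1).
have myy := mfpair _ _ _ _ _ _ mSy (my n.+1).
(* The intermediate term has the first [n + 1] variables already replaced and the last one still
   from [x]; the order of integration is then exchanged to replace the last one. *)
apply: (@le_trans _ _ (\int[P]_w \int[Q]_v
    f ((\sum_(i < n.+1) y i v)%R, x n.+1 w))%E); last first.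
  apply: ge0_le_integral => //.
  - by move=> w _; exact: integral_ge0.
  - exact: (measurable_fun_fubini_tonelli_G _ myx).
  - exact: (measurable_fun_fubini_tonelli_G _ mxx).
  - move=> w _; rewrite /f/=.
    under eq_integral do rewrite addrA addrAC.
    under [leRHS]eq_integral do rewrite addrA addrAC.
    exact: IHx.
rewrite -(fubini_tonelli (m1 := Q) (m2 := P) _ myx)//.
rewrite -(fubini_tonelli (m1 := Q) (m2 := Q) _ myy)//.
apply: ge0_le_integral => //.
- by move=> w _; exact: integral_ge0.
- exact: (measurable_fun_fubini_tonelli_F _ myy).
- exact: (measurable_fun_fubini_tonelli_F _ myx).
- move=> v _; rewrite /f/=.
  under eq_integral do rewrite addrA.
  under [leRHS]eq_integral do rewrite addrA.
  exact: tail_dominated_moment.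
Qed.

End sums.
End moment_comparison.

(** * Symmetrization and independent copies *)

Section borel.
Context {R : realType} {F : normedModType R}.
Local Notation B := (g_sigma_algebraType (@open F)).

Lemma borel_open (A : set F) : open A -> measurable (A : set B).
Proof. exact: sub_sigma_algebra. Qed.

Lemma measurable_borel_continuous (f : F -> R) :
  continuous f -> measurable_fun setT (f : B -> R).
Proof.
move=> /continuousP cf; apply: (measurability _ (RGenOpens.measurableE R)).
move=> _ [A [a [b ->] <-]]; rewrite setTI; apply: borel_open.
by apply: cf; exact: interval_open.
Qed.

Lemma measurable_borel_norm : measurable_fun setT (fun v : B => `|v : F|).
Proof. exact: measurable_borel_continuous (@norm_continuous _ _). Qed.

Lemma measurable_borel_norm_ge t : measurable ([set v | t <= `|v|] : set B).
Proof.
rewrite (_ : [set _ | _] = [set v | t <= `| (`|v : F|) |]).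
  by apply: measurable_ge_abs; exact: measurable_borel_norm.
by apply/seteqP; split => v /=; rewrite normr_id.
Qed.

Lemma measurable_borel_opp : measurable_fun setT ((fun v : F => - v) : B -> B).
Proof.
apply: (@measurability _ _ B B _ _ (@open F : set (set B))) => // _ [A oA <-].
rewrite setTI; apply: borel_open; move: A oA; apply/continuousP.
exact: opp_continuous.
Qed.

End borel.

Section copies.
Context {R : realType}.

Section product_marginals.
Context d1 {T1 : measurableType d1} d2 {T2 : measurableType d2}
  (P1 : probability T1 R) (P2 : probability T2 R).

Lemma product_probability_fst (A : set T1) : measurable A ->
  (P1 \x P2)%E (fst @^-1` A) = P1 A.
Proof.
move=> mA; rewrite (_ : fst @^-1` A = A `*` setT); last first.
  by apply/seteqP; split => [[? ?] //|[? ?] []].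
rewrite product_measure1E// [X in (_ * X)%E](_ : _ = 1%E) ?mule1//.
exact: probability_setT.
Qed.

Lemma product_probability_snd (A : set T2) : measurable A ->
  (P1 \x P2)%E (snd @^-1` A) = P2 A.
Proof.
move=> mA; rewrite (_ : snd @^-1` A = setT `*` A); last first.
  by apply/seteqP; split => [[? ?] //|[? ?] []].
rewrite product_measure1E// [X in (X * _)%E](_ : _ = 1%E) ?mul1e//.
exact: probability_setT.
Qed.

End product_marginals.

(** The space is an iterated product, one factor being added in front at each step. All coordinates
    have law [P], while independence is claimed only for the first [n]. *)
Lemma independent_copies_exist d (T : measurableType d) (P : probability T R)
    (n : nat) :
  exists d' (T' : measurableType d') (Q : probability T' R)
    (pr : nat -> T' -> T),
    [/\ forall i, measurable_fun setT (pr i),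
        forall i A, measurable A -> Q (pr i @^-1` A) = P A &
        independent_upto Q n pr].
Proof.
elim: n => [|n [d' [T' [Q [pr [mpr Qpr ipr]]]]]].
  exists d, T, P, (fun=> id); split => // A mA.
  by rewrite !big_ord0 probability_setT.
have mprA i A : measurable A -> measurable (pr i @^-1` A).
  by move=> mA; rewrite -[X in measurable X]setTI; exact: mpr.
pose pr' i : T * T' -> T := if i is k.+1 then pr k \o snd else fst.
exists _, (T * T')%type, (P \x Q)%E, pr'; split.
- move=> [|i] /=; first exact: measurable_fst.
  exact: (measurableT_comp (mpr i) measurable_snd).
- move=> [|i] A mA; first exact: product_probability_fst.
  by rewrite -(Qpr i A mA); apply: product_probability_snd; exact: mprA.
- move=> A mA; rewrite !big_ord_recl.
  pose D := \big[setI/setT]_(i < n) (pr i @^-1` A i.+1).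
  have mD : measurable D by apply: bigsetI_measurable => i _; exact: mprA.
  rewrite (_ : _ `&` _ = A 0%N `*` D); last first.
    rewrite /D -(bigcap_mkord n (fun i => pr i @^-1` A i.+1)).
    by rewrite -(bigcap_mkord n (fun i => (pr i \o snd) @^-1` A i.+1)).
  rewrite [LHS]product_measure1E//; congr (_ * _)%E.
    exact/esym/product_probability_fst.
  apply: etrans (ipr (fun i => A i.+1) _) _ => //.
  apply: eq_bigr => i _; apply/esym/product_probability_snd; exact: mprA.
Qed.

Lemma bernoulli_half_neg (A : set bool) :
  bernoulli_prob (2^-1 : R) (negb @^-1` A) = bernoulli_prob (2^-1) A.
Proof.
have h : 0 <= (2^-1 : R) <= 1 by apply/andP; split; lra.
have e : 1 - 2^-1 = 2^-1 :> R by lra.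
rewrite !bernoulli_probE// addeC !diracE.
by congr (_%:E * _ + _%:E * _)%E; [exact: e|exact/esym/e].
Qed.

End copies.

Section symmetrization.
Context {R : realType} {F : normedModType R} d {T : measurableType d}
  (P : probability T R) (Y : T -> F).

Definition symmetrized (z : T * bool) : F := if z.2 then Y z.1 else - Y z.1.

Local Notation B := (g_sigma_algebraType (@open F)).
Local Notation Q := (P \x bernoulli_prob (2^-1 : R))%E.

Lemma symmetrized_preimage (A : set F) : symmetrized @^-1` A =
  ((Y @^-1` A) `*` [set true]) `|` (((fun w => - Y w) @^-1` A) `*` [set false]).
Proof.
apply/seteqP; split=> [[w []] /= Aw|[w b] /= [] [/= Aw ->]//].
- by left.
- by right.
Qed.

Lemma symmetrized_preimage_opp (A : set F) :
  (fun z => - symmetrized z) @^-1` A =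
  (((fun w => - Y w) @^-1` A) `*` [set true]) `|` ((Y @^-1` A) `*` [set false]).
Proof.
apply/seteqP; split=> [[w []]|[w b] /= [] [/= Aw ->]];
  rewrite /symmetrized/= ?opprK//.
- by left.
- by right.
Qed.

Hypothesis mY : measurable_fun setT (Y : T -> B).

Let mYA (A : set B) : measurable A -> measurable (Y @^-1` A).
Proof. by move=> mA; rewrite -[X in measurable X]setTI; exact: mY. Qed.

Let mNYA (A : set B) : measurable A -> measurable ((fun w => - Y w) @^-1` A).
Proof.
move=> mA; rewrite -[X in measurable X]setTI.
exact: (measurableT_comp measurable_borel_opp mY).
Qed.

Lemma measurable_symmetrized : measurable_fun setT (symmetrized : _ -> B).
Proof.
move=> _ A mA; rewrite setTI symmetrized_preimage.
by apply: measurableU; apply: measurableX => //; [exact: mYA|exact: mNYA].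
Qed.

Lemma symmetrized_symmetric : symmetric_vector Q symmetrized.
Proof.
move=> A mA; rewrite symmetrized_preimage symmetrized_preimage_opp.
have m1 := mYA mA; have m2 := mNYA mA.
have disj (A1 A2 : set T) : (A1 `*` [set true]) `&` (A2 `*` [set false]) = set0.
  by apply/seteqP; split => // -[w b] /= [[_ ->]] [_].
have mX (A1 : set T) (b : bool) : measurable A1 -> measurable (A1 `*` [set b]).
  by move=> mA1; exact: measurableX.
have b01 : bernoulli_prob (2^-1 : R) [set true] = bernoulli_prob (2^-1) [set false].
  rewrite -bernoulli_half_neg; congr bernoulli_prob.
  by apply/seteqP; split => -[].
pose NYA := (fun w => - Y w) @^-1` A.
transitivity (P (Y @^-1` A) * bernoulli_prob (2^-1 : R) [set true] +
    P NYA * bernoulli_prob (2^-1 : R) [set false])%E.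
  rewrite measureU//; [|exact: mX|exact: mX].
  by congr (_ + _)%E; exact: product_measure1E.
rewrite measureU//; [|exact: mX|exact: mX].
rewrite addeC b01; congr (_ + _)%E; apply/esym.
  by rewrite -b01; exact: product_measure1E.
exact: product_measure1E.
Qed.

(** Sets stable under negation do not see the random sign. This covers the tails of the norm and of
    the absolute value of a functional. *)
Lemma symmetrized_even (A : set B) : measurable A ->
  (forall v, A v -> A (- v)) -> Q (symmetrized @^-1` A) = P (Y @^-1` A).
Proof.
move=> mA AN; rewrite -(product_probability_fst P (bernoulli_prob (2^-1 : R)))//.
  congr (_ _); apply/seteqP; split => -[w []] //=; last exact: AN.
  by move=> /AN; rewrite opprK.
exact: mYA.
Qed.

Lemma symmetrized_ae (S : set F) : S 0 -> (forall v, S v -> S (- v)) ->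
  {ae P, forall w, S (Y w)} -> {ae Q, forall z, S (symmetrized z)}.
Proof.
move=> S0 SN [N [mN PN NS]]; exists (fst @^-1` N); split.
- by rewrite -[X in measurable X]setTI; exact: measurable_fst.
- by rewrite -PN; exact: product_probability_fst.
- move=> [w b] /= nS; apply: NS => /= SY; apply: nS.
  by rewrite /symmetrized/=; case: b => //; exact: SN.
Qed.

End symmetrization.

(** * Functionals on l_infty^n(F) *)

Section linfty_functionals.
Context {R : realType} {F : normedModType R} (n : nat).

(** The index is a natural number, in line with sequences of random vectors; for [i >= n] this is
    the zero map. *)
Definition linfty_inj (i : nat) (v : F) : linfty F n :=
  [ffun j : 'I_n => if j == i :> nat then v else 0].

Lemma linfty_injP (a : R) i u v :
  linfty_inj i (a *: u + v) = a *: linfty_inj i u + linfty_inj i v.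
Proof.
apply/ffunP => j; rewrite !ffunE; case: ifP => // _.
by rewrite scaler0 addr0.
Qed.

Lemma linfty_inj_norm i v : `|linfty_inj i v| <= `|v|.
Proof.
by apply: linfty_norm_le => // j; rewrite ffunE; case: ifP; rewrite ?normr0.
Qed.

Lemma linfty_sum_inj (v : linfty F n) (w : nat -> F) :
  (forall i : 'I_n, v i = w i) -> v = \sum_(i < n) linfty_inj i (w i).
Proof.
move=> vw; apply/ffunP => j; rewrite sum_ffunE vw (bigD1 j)//= ffunE eqxx.
rewrite big1 ?addr0// => i ij; rewrite ffunE ifN//.
by apply: contra ij => /eqP/val_inj ->.
Qed.

Lemma dual_space_linfty_inj (g : linfty F n -> R^o) i :
  dual_space g -> dual_space (g \o linfty_inj i).
Proof.
move=> [lg cg]; split => [a u v|v] /=; first by rewrite linfty_injP lg.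
apply: (continuous_comp _ (cg _)).
apply/cvgrPdist_le => e e0; near=> u.
have -> : linfty_inj i v - linfty_inj i u = linfty_inj i (v - u).
  by rewrite addrC -scaleN1r -linfty_injP scaleN1r addrC.
apply: le_trans (linfty_inj_norm _ _) _.
near: u; exact: cvgr_dist_le.
Unshelve. all: by end_near. Qed.

Lemma linear_functional_sum (g : linfty F n -> R^o) (w : nat -> F) : linear g ->
  g (\sum_(i < n) linfty_inj i (w i)) = \sum_(i < n) g (linfty_inj i (w i)).
Proof.
move=> lg.
pose g' : {linear linfty F n -> R^o} :=
  HB.pack g (GRing.isLinear.Build _ _ _ _ g lg).
exact: (raddf_sum g').
Qed.

Lemma dual_ball_linfty_proj (f : F -> R^o) (i : 'I_n) : linear f ->
  (forall v, `|f v| <= `|v|) ->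
  dual_ball (fun v : linfty F n => f (v i)).
Proof.
move=> lf fb.
have fib (v : linfty F n) : `|f (v i)| <= `|v|.
  exact: le_trans (fb _) (le_linfty_norm _ _).
split; first by apply: bounded_dual_space => // a u v; rewrite !ffunE lf.
apply: sup_le_ub => [|_ [v /= v1 <-]]; last exact: le_trans v1.
by exists `|f ((0 : linfty F n) i)|, 0 => //=; rewrite normr0.
Qed.

End linfty_functionals.

(** * Tail estimates *)

Section moment_tail.
Context {R : realType} d {T : measurableType d} (P : probability T R).

Lemma markov_powR (z : T -> R) (p t : R) : 0 <= p -> 0 < t ->
  measurable_fun setT z ->
  ((t `^ p)%:E * P [set w | (t <= `|z w|)%R] <= \int[P]_w (`|z w| `^ p)%:E)%E.
Proof.
move=> p0 t0 mz.
pose Z : {RV P >-> R} := HB.pack z (isMeasurableFun.Build _ _ _ _ z mz).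
have := @markov _ _ _ P Z (@powR R ^~ p) t t0 (measurable_powR p).
rewrite unlock /=; apply => [r _|r s]; first exact: powR_ge0.
by rewrite !nnegrE => r0 s0 rs; apply: ge0_ler_powR.
Qed.

Lemma Lnorm_integral_powR (z : T -> R) (p : R) : p != 0 ->
  ('N[P]_p%:E [EFin \o z] `^ p = \int[P]_w (`|z w| `^ p)%:E)%E.
Proof. by move=> p0; rewrite powR_Lnorm. Qed.

End moment_tail.

Section tail_series.
Context {R : realType}.

(** From [1 + x <= expR x] at [x = -1/8], [expR (1/8) <= 8/7], and the eighth power of [8/7] is
    below 3. *)
Lemma expR1_le3 : expR 1 <= 3 :> R.
Proof.
have e8 : expR (1 / 8) <= 8 / 7 :> R.
  have := expR_ge1Dx (- (1 / 8) : R); rewrite expRN => h.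
  rewrite -[leLHS]invrK -[leRHS]invrK lef_pV2 ?posrE ?invr_gt0 ?expR_gt0//; lra.
have -> : 1 = 8%:R * (1 / 8) :> R by field.
rewrite expRM_natl; apply: (@le_trans _ _ ((8 / 7) ^+ 8)).
  by apply: lerXn2r; rewrite ?nnegrE ?expR_ge0//; lra.
lra.
Qed.

Lemma ln_ge1 (m : nat) : (3 <= m)%N -> 1 <= ln m%:R :> R.
Proof.
move=> m3; rewrite -ler_expR lnK ?posrE ?ltr0n; last exact: leq_trans m3.
by apply: le_trans expR1_le3 _; rewrite ler_nat.
Qed.

(** The left side is [m] to the power [- ln 80], and [ln 80 >= 3] because the cube of e is at most
    27. *)
Lemma powR80_ln_le (m : nat) : (0 < m)%N ->
  (80^-1) `^ (ln m%:R) <= (m%:R ^+ 3)^-1 :> R.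
Proof.
move=> m0; have m_gt0 : 0 < m%:R :> R by rewrite ltr0n.
have ln80 : 3 <= ln 80 :> R.
  rewrite -ler_expR lnK ?posrE; last by lra.
  have -> : expR 3 = expR 1 ^+ 3 :> R by rewrite -expRM_natl mulr1.
  apply: (@le_trans _ _ (3 ^+ 3)); last by lra.
  by apply: lerXn2r; rewrite ?nnegrE ?expR_ge0//; exact: expR1_le3.
rewrite /powR invr_eq0 ifF; last by apply/negbTE; lra.
rewrite lnV ?posrE; last by lra.
rewrite -[m%:R ^+ 3]lnK ?posrE ?exprn_gt0// -expRN ler_expR lnXn//.
rewrite -(mulr_natr (ln _))  mulrN lerN2; apply: ler_wpM2l => //.
by apply: ln_ge0; rewrite ler1n.
Qed.

(** Telescoping: since [3 (x + 2) <= (x + 3)^2], the term with base [x + 3] is at most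
    [(1/(x + 2) - 1/(x + 3)) / 3]; the first of these differences contributes the value 1/6. *)
Lemma sum_inv_cube_le (n : nat) :
  \sum_(0 <= m < n) ((m + 3)%:R ^+ 3)^-1 <= 1 / 6 - (3 * (n + 2)%:R)^-1 :> R.
Proof.
elim: n => [|n IHn]; first by rewrite big_nil add0n; lra.
rewrite big_nat_recr//=; apply: le_trans (lerD IHn (lexx _)) _.
have -> : (n.+1 + 2)%:R = n%:R + 3 :> R by rewrite addSn -addnS natrD.
rewrite !natrD; have : 0 <= n%:R :> R by exact: ler0n.
move: (n%:R : R) => x x0.
suff : ((x + 3) ^+ 3)^-1 <= (3 * (x + 2))^-1 - (3 * (x + 3))^-1 by lra.
have -> : (3 * (x + 2))^-1 - (3 * (x + 3))^-1 = (3 * (x + 2) * (x + 3))^-1.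
  by field; apply/andP; split; apply/lt0r_neq0; lra.
have h1 : 0 < x + 2 by lra.
have h2 : 0 < x + 3 by lra.
rewrite lef_pV2 ?posrE ?mulr_gt0 ?exprn_gt0//.
by rewrite exprSr ler_wpM2r ?ltW//; nra.
Qed.

End tail_series.

(** * Transfer of the regularity of the [Xs] vector to the [Ys] vector *)

Section vector_domination.
Context {R : realType} {F : normedModType R}.
Local Notation B := (g_sigma_algebraType (@open F)).
Context dS {TS : measurableType dS} (PS : probability TS R)
  dU {TU : measurableType dU} (PU : probability TU R).
Variables (Xs : nat -> TS -> F) (Ys : nat -> TU -> F) (n : nat).
Hypotheses (mX : forall i, measurable_fun setT (Xs i : TS -> B))
  (mY : forall i, measurable_fun setT (Ys i : TU -> B))
  (sX : forall i, symmetric_vector PS (Xs i))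
  (sY : forall i, symmetric_vector PU (Ys i))
  (iX : @independent_upto _ _ _ PS _ B n Xs)
  (iY : @independent_upto _ _ _ PU _ B n Ys)
  (YX : forall i, weak_tail_dominated PU PS (Ys i) (Xs i)).

Lemma measurable_dual_space (f : F -> R^o) :
  dual_space f -> measurable_fun setT (f : B -> R).
Proof. by move=> [_ cf]; exact: measurable_borel_continuous. Qed.

Lemma first_vectors_functional (T : Type) (Z : nat -> T -> F)
    (g : linfty F n -> R^o) (w : T) : linear g ->
  g (first_vectors Z n w) = \sum_(i < n) g (linfty_inj n i (Z i w)).
Proof.
move=> lg; rewrite -(linear_functional_sum (fun i => Z i w) lg); congr g.
by apply: (linfty_sum_inj (w := fun i => Z i w)) => i; rewrite ffunE.
Qed.

Lemma measurable_first_vectors d (T : measurableType d) (Z : nat -> T -> F)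
    (g : linfty F n -> R^o) : (forall i, measurable_fun setT (Z i : T -> B)) ->
  dual_space g -> measurable_fun setT (fun w => g (first_vectors Z n w) : R).
Proof.
move=> mZ dg; under eq_fun do rewrite (first_vectors_functional _ _ dg.1).
apply: measurable_sum => i.
have mg := measurable_dual_space (dual_space_linfty_inj i dg).
exact: (measurableT_comp mg (mZ i)).
Qed.

Lemma weak_tail_dominated_moment (g : linfty F n -> R^o) (p : R) :
  1 <= p -> dual_space g ->
  (\int[PU]_w (`|g (first_vectors Ys n w)| `^ p)%:E <=
   \int[PS]_w (`|g (first_vectors Xs n w)| `^ p)%:E)%E.
Proof.
move=> p1 dg; have lg := dg.1.
pose f i : B -> R := g \o linfty_inj n i.
have mf i : measurable_fun setT (f i).
  exact: measurable_dual_space (dual_space_linfty_inj i dg).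
have fN i v : f i (- v) = - f i v.
  by have [lfi _] := dual_space_linfty_inj i dg; exact: linear_fun_opp.
have sf d0 (T0 : measurableType d0) (P0 : probability T0 R) (Z : T0 -> F) i :
    symmetric_vector P0 Z -> symmetric_variable P0 (f i \o Z).
  move=> sZ A mA.
  have -> : (\- (f i \o Z)) @^-1` A = (fun w => - Z w) @^-1` (f i @^-1` A).
    by apply/seteqP; split => w /=; rewrite fN.
  by apply: sZ; rewrite -[X in measurable X]setTI; exact: mf.
under eq_integral do rewrite first_vectors_functional// -[X in `|X|]add0r.
under [leRHS]eq_integral do rewrite first_vectors_functional// -[X in `|X|]add0r.
apply: (tail_dominated_sum_moment p1
  (fun i => measurableT_comp (mf i) (mX i)) (fun i => measurableT_comp (mf i) (mY i))
  (fun i => sf _ _ PS _ i (sX i)) (fun i => sf _ _ PU _ i (sY i)) _ 0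
  (independent_upto_comp mf iX) (independent_upto_comp mf iY)).
by move=> i t t0; apply: YX => //; exact: dual_space_linfty_inj.
Qed.

Local Notation VX := (first_vectors Xs n).
Local Notation VY := (first_vectors Ys n).

Lemma weak_tail_dominated_Lnorm (g : linfty F n -> R^o) (p : R) :
  1 <= p -> dual_space g ->
  (\int[PU]_w (`|g (VY w)| `^ p)%:E <=
   'N[PS]_p%:E [(fun w => (g (VX w))%:E)] `^ p)%E.
Proof.
move=> p1 dg; rewrite (Lnorm_integral_powR PS (fun w => g (VX w))).
  exact: weak_tail_dominated_moment.
by rewrite gt_eqF// (lt_le_trans ltr01).
Qed.

(** Markov's inequality at the exponent [p = ln m], which is at least 1 for [m >= 3]: the
    probability is at most [(c / t)^p <= 80^-p]. *)
Lemma functional_tail_le (g : linfty F n -> R^o) (c t : R) (m : nat) :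
  (3 <= m)%N -> dual_space g -> 0 < t -> 0 <= c -> 80 * c <= t ->
  ('N[PS]_(ln m%:R)%:E [(fun w => (g (VX w))%:E)] <= c%:E)%E ->
  (PU [set w | (t <= `|g (VY w)|)%R] <= ((m%:R ^+ 3)^-1)%:E)%E.
Proof.
move=> m3 dg t0 c0 ct gc; have p1 := @ln_ge1 R _ m3.
move: p1 gc; set p : R := ln m%:R => p1 gc.
have p0 : 0 <= p by exact: le_trans p1.
have := markov_powR PU p0 t0 (measurable_first_vectors mY dg).
move=> /le_trans/(_ (weak_tail_dominated_Lnorm p1 dg)) tP.
have cP : ('N[PS]_p%:E [(fun w => (g (VX w))%:E)] `^ p <= (c `^ p)%:E)%E.
  rewrite -poweR_EFin; apply: gt0_ler_poweR => //.
    by rewrite in_itv/= Lnorm_ge0 leey.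
  by rewrite in_itv/= lee_fin c0 leey.
have {tP cP} := le_trans tP cP.
rewrite -lee_pdivlMl ?powR_gt0// -EFinM => /le_trans; apply.
rewrite lee_fin; apply: (le_trans _ (powR80_ln_le (leq_trans _ m3))) => //.
rewrite -/p ler_pdivrMl ?powR_gt0// mulrC -powRM//; last exact: ltW.
by apply: ge0_ler_powR; rewrite ?nnegrE//; lra.
Qed.

Variable x : nat -> linfty F n -> R^o.
Hypothesis dx : forall m, (0 < m)%N -> dual_space (x m).
Local Notation hull := (convex_hull
  [set f | exists2 m, (0 < m)%N & f = x m \/ f = (fun v => - x m v)]).

Lemma hull_dual_space g : hull g -> dual_space g.
Proof.
apply: convex_hull_dual_space => f [m m0 [->|->]]; first exact: dx.
by apply: dual_spaceN; exact: dx.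
Qed.

(* An element [g] of the hull with [f - g] small in [L^2(X)] is bounded by [s] on
   this set, so that [`|f - g| >= t - s] there; the second moment of [f - g]
   under [Y] is at most the one under [X]. *)
Lemma L2_closure_null f (s t : R) : s < t -> L2_closure PS VX hull f ->
  PU.-negligible [set w | (forall m, (0 < m)%N -> `|x m (VY w)| <= s) /\
                          t <= `|f (VY w)|].
Proof.
move=> st [df fcl].
have st0 : 0 < t - s by rewrite subr_gt0.
have mE g : dual_space g -> measurable [set w | t - s <= `|g (VY w)|].
  by move=> dg; apply: measurable_ge_abs; exact: measurable_first_vectors.
pose E := [set w | (forall m, (0 < m)%N -> `|x m (VY w)| <= s) /\
                          t <= `|f (VY w)|].
have mEE : measurable E.
  rewrite (_ : E = (\bigcap_(m in [set m | (0 < m)%N])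
      ~` [set w | s < `|x m (VY w)|]) `&` [set w | t <= `|f (VY w)|]).
    apply: measurableI; last first.
      by apply: measurable_ge_abs; exact: measurable_first_vectors.
    apply: bigcap_measurableType => m m0; apply: measurableC.
    by apply: measurable_gt_abs; apply: measurable_first_vectors => //; exact: dx.
  apply/seteqP; split => w [xs tf]; split => //= m m0.
    by apply/negP; rewrite -leNgt xs.
  by have /negP := xs m m0; rewrite -leNgt.
apply/negligibleP => //; apply/eqP; rewrite eq_le measure_ge0 andbT.
apply/lee_addgt0Pr => e e0; rewrite add0e.
(* With this radius in the second moment, Chebyshev's bound at level [t - s] is exactly [e]. *)
have de : 0 < Num.sqrt e * (t - s) by rewrite mulr_gt0 ?sqrtr_gt0.
have [g hg fg] := fcl _ de.
have dg := hull_dual_space hg.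
have dfg := dual_spaceB df dg.
have EE : E `<=` [set w | t - s <= `|f (VY w) - g (VY w)|].
  move=> w [xs tf] /=.
  have : `|g (VY w)| <= s.
    apply: (convex_hull_norm_le hg) => h [m m0 [->|->]]; rewrite ?normrN; exact: xs.
  have := ler_dist_dist (f (VY w)) (g (VY w)); rewrite ler_norml => /andP[_].
  lra.
apply: (@le_trans _ _ (PU [set w | t - s <= `|f (VY w) - g (VY w)|])).
  by apply: le_measure; rewrite ?inE//; exact: (mE (fun v => f v - g v)).
have two1 : (1 : R) <= 2 by lra.
have := markov_powR PU (le_trans ler01 two1) st0 (measurable_first_vectors mY dfg).
move=> /le_trans/(_ (weak_tail_dominated_Lnorm two1 dfg)) h1.
have h2 : ('N[PS]_2%:E [(fun w => (f (VX w) - g (VX w))%:E)] `^ 2 <=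
    ((Num.sqrt e * (t - s)) `^ 2)%:E)%E.
  rewrite -poweR_EFin; apply: gt0_ler_poweR => //.
  - by rewrite in_itv/= Lnorm_ge0 leey.
  - by rewrite in_itv/= lee_fin (ltW de) leey.
  - exact: ltW.
have {h1 h2} := le_trans h1 h2.
rewrite -lee_pdivlMl ?powR_gt0// -EFinM => /le_trans; apply.
rewrite lee_fin powRM ?sqrtr_ge0 ?(ltW st0)// mulrCA mulVf ?gt_eqF ?powR_gt0// mulr1.
by rewrite powR_mulrn ?sqrtr_ge0// sqr_sqrtr ?(ltW e0).
Qed.

Variable (c : R).
Hypotheses (c0 : 0 <= c)
  (xc : forall m, (0 < m)%N ->
    ('N[PS]_(ln (m + 2)%:R)%:E [(fun w => (x m (VX w))%:E)] <= c%:E)%E).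

(** Union bound. The functional [x m.+1] has exponent [ln (m + 3)], so its tail is at most the
    inverse cube of [m + 3]. *)
Lemma sup_functionals_tail_le t : 0 < t -> 80 * c <= t ->
  (PU (\bigcup_m [set w | (t <= `|x m.+1 (VY w)|)%R]) <= (1 / 6)%:E)%E.
Proof.
move=> t0 ct.
have mE m : measurable [set w | t <= `|x m.+1 (VY w)|].
  by apply: measurable_ge_abs; apply: measurable_first_vectors => //; exact: dx.
apply: le_trans.
  apply: (@measure_sigma_subadditive _ _ _ PU _ _ mE) => //.
  exact: bigcup_measurable.
apply: lime_le; first by apply: is_cvg_nneseries => *; exact: measure_ge0.
apply: nearW => N.
apply: (@le_trans _ _ (\sum_(0 <= m < N) ((m + 3)%:R ^+ 3)^-1%R%:E)%E).
  apply: lee_sum => m _; rewrite [(m + 3)%N]addnS -addSn.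
  have m3 : (3 <= m.+1 + 2)%N by rewrite addn2.
  exact: (functional_tail_le m3 (dx (ltn0Sn m)) t0 c0 ct (xc (ltn0Sn m))).
rewrite sumEFin lee_fin; apply: le_trans (sum_inv_cube_le N) _.
by rewrite gerBl invr_ge0 mulr_ge0.
Qed.

Hypothesis ball_closure : dual_ball `<=` L2_closure PS VX hull.
Variable S : set F.
Hypotheses (sS : separable_set S) (YS : forall i, {ae PU, forall w, S (Ys i w)}).

Lemma measurable_max_tail t :
  measurable [set w | exists2 i, (i < n)%N & t <= `|Ys i w|].
Proof.
rewrite (_ : [set _ | _] =
    \bigcup_(i in [set i | (i < n)%N]) [set w | t <= `|Ys i w|]).
  apply: bigcup_measurable => i _.
  rewrite -[X in measurable X]setTI.
  exact: (mY i measurableT (measurable_borel_norm_ge t)).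
by apply/seteqP; split => w /= [i ? ?]; exists i.
Qed.

(** Outside a null set, a norm at least [t] forces some [x m] above a level slightly below [t]: a
    functional norming a nearby point of a countable dense set is large at [Ys i], and
    [L2_closure_null] excludes that all [x m] are small there. *)
Lemma max_tail_le t : 80 * c < t ->
  (PU [set w | exists2 i, (i < n)%N & (t <= `|Ys i w|)%R] <= (1 / 6)%:E)%E.
Proof.
move=> ct.
(* Two intermediate levels: the gap from [s1] to [s2] serves the closure argument, the gap from [s2]
   to [t] the approximation by dense points. *)
pose s1 := (80 * c + t) / 2; pose s2 := (s1 + t) / 2.
have ct1 : 80 * c < s1 by rewrite /s1; lra.
have s12 : s1 < s2 by rewrite /s2 /s1; lra.
have s2t : s2 < t by rewrite /s2 /s1; lra.
have s10 : 0 < s1 by apply: le_lt_trans ct1; rewrite mulr_ge0.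
have [D [cD DS SD]] := sS.
have [f fP] := choice (@norming_functional R F).
(* Only an inclusion is asked, so that an empty [D] is also enumerated. *)
have [d Dd] : exists d : nat -> F, D `<=` range d.
  have [->|[d]] := pfcard_geP cD; first by exists (fun=> 0).
  by exists d => v /(@surj _ _ _ _ d)[k _ <-]; exists k.
have good : {ae PU, forall w, (forall i, S (Ys i w)) /\
  forall i k, (i < n)%N ->
    ~ ((forall m, (0 < m)%N -> `|x m (VY w)| <= s1) /\ s2 <= `|f (d k) (Ys i w)|)}.
  apply: filterI.
    by apply: ae_foralln.
  apply: ae_foralln => i; apply: ae_foralln => k.
  have [ni|ni] := ltnP i n; last by apply: aeW => w.
  have [lf fb _] := fP (d k).
  have := L2_closure_null s12
    (ball_closure (dual_ball_linfty_proj (Ordinal ni) lf fb)).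
  apply: negligibleS => w /= /not_implyP[_ /contrapT[xs ft]]; split => //.
  by rewrite ffunE.
have [N [mN PN NP]] := good.
apply: (@le_trans _ _ (PU (\bigcup_m [set w | (s1 <= `|x m.+1 (VY w)|)%R] `|` N))).
  apply: le_measure; rewrite ?inE.
  - exact: measurable_max_tail.
  - apply: measurableU => //; apply: bigcup_measurable => m _.
    by apply: measurable_ge_abs; apply: measurable_first_vectors => //; exact: dx.
  - move=> w [i ni ti].
    have [Ux|Ux] := pselect ((\bigcup_m [set w | s1 <= `|x m.+1 (VY w)|]) w).
      by left.
    right; apply: NP => -[Sw fw].
    (* The distance is lost twice, once in the norm of [d k] and once in the value of its functional
       at [Ys i w], hence the half. *)
    have e0 : 0 < (t - s2) / 2 by rewrite divr_gt0// subr_gt0.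
    have [v [/Dd[k _ dk] dist]] := SD _ (Sw i) _ (nbhsx_ballx (Ys i w) _ e0).
    apply: (fw i k ni); split.
      move=> [//|m] _; rewrite leNgt; apply/negP => sx; apply: Ux.
      by exists m => //=; exact: ltW.
    move: dist; rewrite -dk -ball_normE /ball_/= => dist.
    have [lf fb fd] := fP (d k).
    have fB := linear_fun_sub (Ys i w) (d k) lf.
    have h1 := fb (Ys i w - d k).
    have h2 : `|Ys i w| <= `|d k| + `|Ys i w - d k|.
      by rewrite -[X in `|X| <= _](subrK (d k)) addrC ler_normD.
    move: h1; rewrite ler_norml => /andP[h1 _].
    apply: le_trans (ler_norm _); rewrite fB fd in h1; lra.
apply: le_trans (measureU2 _ _ _) _ => //.
  apply: bigcup_measurable => m _.
  by apply: measurable_ge_abs; apply: measurable_first_vectors => //; exact: dx.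
rewrite [X in (_ + X <= _)%E](_ : _ = 0%E)// adde0.
by apply: sup_functionals_tail_le => //; exact: ltW.
Qed.

End vector_domination.

(** * Laws of copies and the maximum of independent norms *)

Section copies_of_vectors.
Context {R : realType} {F : normedModType R}.
Local Notation B := (g_sigma_algebraType (@open F)).

Lemma mutually_independent_upto d (T : measurableType d) (P : probability T R)
    (X : nat -> T -> F) n :
  mutually_independent P X -> @independent_upto _ _ _ P _ B n X.
Proof.
move=> iX A mA; have := iX (seq_fset tt (iota 0 n)) A (fun i _ => mA i).
have perm : perm_eq (seq_fset tt (iota 0 n)) (index_iota 0 n).
  rewrite (perm_trans (seq_fset_perm _ _))//.
  by rewrite undup_id ?iota_uniq// /index_iota subn0.
by rewrite bigcap_fset !(perm_big _ perm) !big_mkord.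
Qed.

Lemma symmetric_same_distribution d (T : measurableType d) (P : probability T R)
    d' (T' : measurableType d') (Q : probability T' R)
    (X : T -> F) (Z : T' -> F) :
  same_distribution Q P Z X -> symmetric_vector P X -> symmetric_vector Q Z.
Proof.
move=> ZX sX A mA; rewrite ZX// sX//.
rewrite [RHS](ZX (-%R @^-1` A))//.
by rewrite -[X in measurable X]setTI; exact: measurable_borel_opp.
Qed.

Lemma weak_tail_dominated_same_distribution
    d1 (T1 : measurableType d1) (P1 : probability T1 R)
    d2 (T2 : measurableType d2) (P2 : probability T2 R)
    d3 (T3 : measurableType d3) (P3 : probability T3 R)
    (Y : T1 -> F) (X : T2 -> F) (Z : T3 -> F) :
  same_distribution P3 P2 Z X ->
  weak_tail_dominated P1 P2 Y X -> weak_tail_dominated P1 P3 Y Z.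
Proof.
move=> ZX YX f t df t0; apply: (le_trans (YX f t df t0)).
rewrite -[leLHS](ZX [set v | t <= `|f v|])//.
by apply: measurable_ge_abs; exact: measurable_dual_space.
Qed.

(** Bernoulli's inequality gives [(1 + p)^n >= 1 + n p >= 2], while the product of [(1 - p)^n] and
    [(1 + p)^n] is at most 1. *)
Lemma pow_onem_le_half (p : R) (n : nat) : 0 <= p <= 1 -> 1 <= n%:R * p ->
  (1 - p) ^+ n <= 1 / 2.
Proof.
move=> /andP[p0 p1] np.
have bern m : 1 + m%:R * p <= (1 + p) ^+ m.
  elim: m => [|m IHm]; first by rewrite mul0r addr0 expr0.
  rewrite exprS -addn1 natrD.
  have m0 : 0 <= m%:R :> R by [].
  apply: (@le_trans _ _ ((1 + p) * (1 + m%:R * p))); first by nra.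
  by rewrite ler_wpM2l//; lra.
have h1 : (1 - p) ^+ n * (1 + p) ^+ n <= 1.
  by rewrite -exprMn exprn_ile1//; nra.
have h2 := bern n.
have h3 : 0 <= (1 - p) ^+ n by rewrite exprn_ge0//; lra.
have h4 : (1 - p) ^+ n * 2 <= (1 - p) ^+ n * (1 + p) ^+ n.
  by rewrite ler_wpM2l//; lra.
lra.
Qed.

Lemma max_tail_ge_half d (T : measurableType d) (P : probability T R)
    (Z : nat -> T -> F) n (p t : R) :
  (forall i, measurable_fun setT (Z i : T -> B)) ->
  @independent_upto _ _ _ P _ B n Z ->
  (forall i, P [set w | (t <= `|Z i w|)%R] = p%:E) ->
  1 <= n%:R * p ->
  ((1 / 2)%:E <= P [set w | exists2 i, (i < n)%N & (t <= `|Z i w|)%R])%E.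
Proof.
move=> mZ iZ Zp np.
have mtail i : measurable [set w | t <= `|Z i w|].
  rewrite -[X in measurable X]setTI.
  exact: (mZ i measurableT _ (measurable_borel_norm_ge t)).
have mlt : measurable ([set v | `|v| < t] : set B).
  rewrite (_ : [set _ | _] = ~` [set v | t <= `|v|]).
    by apply: measurableC; exact: measurable_borel_norm_ge.
  by apply/seteqP; split => v /=; rewrite ltNge => /negP.
have p01 : 0 <= p <= 1.
  by rewrite -!lee_fin -(Zp 0%N) measure_ge0 probability_le1.
have ltp i : P (Z i @^-1` [set v | `|v| < t]) = (1 - p)%:E.
  rewrite (_ : _ @^-1` _ = ~` [set w | t <= `|Z i w|]); last first.
    by apply/seteqP; split => w /=; rewrite ltNge => /negP.
  by rewrite probability_setC// Zp.
have mall : measurable (\big[setI/setT]_(i < n) (Z i @^-1` [set v | `|v| < t])).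
  apply: bigsetI_measurable => i _; rewrite -[X in measurable X]setTI.
  exact: mZ.
rewrite (_ : [set _ | _] =
    ~` \big[setI/setT]_(i < n) (Z i @^-1` [set v | `|v| < t])); last first.
  rewrite -(bigcap_mkord n (fun i => Z i @^-1` [set v | `|v| < t])).
  apply/seteqP; split => w /=.
    by move=> [i ni ti] /(_ i ni) /=; rewrite ltNge ti.
  move=> /existsNP[i /not_implyP[ni /negP]]; rewrite -leNgt => ti.
  by exists i.
rewrite probability_setC// (iZ (fun=> [set v | `|v| < t]))//.
under eq_bigr do rewrite ltp.
rewrite prodEFin big_const_ord iter_mulr_1 -EFinB lee_fin.
by have := pow_onem_le_half p01 np; lra.
Qed.

End copies_of_vectors.

Theorem theorem1 (R : realType) (F : completeNormedModType R)
  (dX : measure_display) (TX : measurableType dX) (PX : probability TX R)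
  (X : TX -> F)
  (dS : measure_display) (TS : measurableType dS) (PS : probability TS R)
  (Xs : nat -> TS -> F)
  (hX : random_vector PX X)
  (hsym : symmetric_vector PX X)
  (hXs : independent_copies PX PS X Xs)
  (K alpha beta : R)
  (hK : 0 < K) (halpha : 0 < alpha) (hbeta : 0 < beta)
  (hreg : forall n : nat, (0 < n)%N -> K_regular PS K (first_vectors Xs n))
  (hmax : forall n : nat, (0 < n)%N ->
    (beta%:E <=
     PS [set w |
       alpha%:E * 'E_PS[fun w' => (\big[Num.max/0]_(i < n) `|Xs i w'|)%R]
       <= (\big[Num.max/0]_(i < n) `|Xs i w|)%R%:E])%E)
  (dY : measure_display) (TY : measurableType dY) (PY : probability TY R)
  (Y : TY -> F)
  (hY : random_vector PY Y)
  (hYX : weak_tail_dominated PY PX Y X)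
  (t : R) (ht : 0 < t) :
  (PY [set w | (t <= `|Y w|)%R]
   <= (2 / beta)%:E * PX [set w | (alpha * t / (80 * K) <= `|X w|)%R])%E.
Proof.
have [mY [S [linS sepS YS]]] := hY.
have [rXs lawXs indXs] := hXs.
have mX := hX.1.
have mXs i := (rXs i).1.
have mnorm_ge := @measurable_borel_norm_ge R F.
pose r := alpha * t / (80 * K).
have r0 : 0 < r by rewrite /r divr_gt0 ?mulr_gt0.
pose q := fine (PX [set w | r <= `|X w|]).
have mtX s : measurable [set w | s <= `|X w|].
  by rewrite -[X in measurable X]setTI; exact: (mX measurableT _ (mnorm_ge s)).
have mtY s : measurable [set w | s <= `|Y w|].
  by rewrite -[X in measurable X]setTI; exact: (mY measurableT _ (mnorm_ge s)).
pose p := fine (PY [set w | t <= `|Y w|]).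
have pE : PY [set w | t <= `|Y w|] = p%:E by rewrite fineK// fin_num_measure.
have qE : PX [set w | r <= `|X w|] = q%:E by rewrite fineK// fin_num_measure.
have p0 : 0 <= p by rewrite -lee_fin -pE.
have p1 : p <= 1 by rewrite -lee_fin -pE probability_le1.
have q0 : 0 <= q by rewrite -lee_fin -qE.
rewrite pE qE -EFinM lee_fin.
have [->|p_neq0] := eqVneq p 0; first by rewrite mulr_ge0// divr_ge0// ltW.
have p_gt0 : 0 < p by rewrite lt0r p_neq0.
(* Then [1/p < n <= 1/p + 1 <= 2/p], the last step because [p <= 1]. *)
pose n := (Num.truncn p^-1).+1.
have n0 : (0 < n)%N by [].
have np : 1 <= n%:R * p.
  by rewrite -ler_pdivrMr// div1r ltW// truncnS_gt.
have n2p : n%:R * p <= 2.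
  rewrite -ler_pdivlMr// /n -natr1.
  have : (Num.truncn p^-1)%:R <= p^-1 by rewrite truncn_le// invr_ge0.
  have : 1 <= p^-1 by rewrite invf_ge1.
  lra.
pose M : \bar R := ('E_PS[fun w => (\big[Num.max/0]_(i < n) `|Xs i w|)%R])%E.
have [x [dx xK ball]] := hreg n n0.
have normE : (fun w => `|first_vectors Xs n w|) =
    (fun w => \big[Num.max/0]_(i < n) `|Xs i w|).
  by apply/funext => w; apply: eq_bigr => i _; rewrite ffunE.
have M0 : (0 <= M)%E by rewrite expectation_ge0// => w; exact: bigmax_ge_id.
(* If the expected maximum were infinite, the event in [hmax] would be empty, contradicting
   [beta > 0]. *)
have Mfin : (M < +oo)%E.
  rewrite ltey; apply/eqP => Moo; have := hmax n n0.
  rewrite -/M Moo gt0_muley ?lte_fin//.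
  rewrite (_ : [set _ | _] = set0) ?measure0 ?leNgt ?lte_fin ?hbeta//.
  by apply/seteqP; split.
pose m := fine M.
have mE : M = m%:E by rewrite fineK// ge0_fin_numE.
have m0 : 0 <= m by rewrite -lee_fin -mE.
have [d' [T' [Q [pr [mpr lawpr indpr]]]]] :=
  independent_copies_exist (PY \x bernoulli_prob (2^-1 : R))%E n.
pose Z i := symmetrized Y \o pr i.
have mZ i : measurable_fun setT (Z i : _ -> g_sigma_algebraType (@open F)).
  exact: (measurableT_comp (measurable_symmetrized mY) (mpr i)).
have lawZ i : same_distribution Q (PY \x bernoulli_prob (2^-1 : R))%E
    (Z i) (symmetrized Y).
  move=> A mA; rewrite -[LHS]/(Q (pr i @^-1` (symmetrized Y @^-1` A))).
  apply: lawpr; rewrite -[X in measurable X]setTI.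
  exact: (measurable_symmetrized mY).
have evenZ i (A : set (g_sigma_algebraType (@open F))) : measurable A ->
    (forall v, A v -> A (- v)) -> Q (Z i @^-1` A) = PY (Y @^-1` A).
  by move=> mA AN; rewrite lawZ//; exact: (symmetrized_even PY mY).
have ZX i : weak_tail_dominated Q PS (Z i) (Xs i).
  apply: (weak_tail_dominated_same_distribution (lawXs i)) => f s df s0.
  apply: le_trans (hYX f s df s0); rewrite [leLHS](evenZ i [set v | s <= `|f v|])//.
    by apply: measurable_ge_abs; exact: measurable_dual_space.
  by move=> v /=; rewrite (linear_fun_opp _ df.1) normrN.
have ZS i : {ae Q, forall w, S (Z i w)}.
  have [S0 SL] := linS.
  have SN v : S v -> S (- v).
    by move=> Sv; have := SL (-1) v 0 Sv S0; rewrite addr0 scaleN1r.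
  have [N [mN PN NS]] := symmetrized_ae S0 SN YS.
  exists (pr i @^-1` N); split.
    by rewrite -[X in measurable X]setTI; exact: mpr.
    by rewrite -PN; exact: lawpr.
  by move=> w nS; exact: NS.
have iZ : @independent_upto _ _ _ Q _ (g_sigma_algebraType (@open F)) n Z.
  exact: (@independent_upto_comp _ _ _ Q _ _ _ (g_sigma_algebraType (@open F))
    n pr (fun=> symmetrized Y) (fun=> measurable_symmetrized mY) indpr).
have Zp i : Q [set w | t <= `|Z i w|] = p%:E.
  rewrite -pE; apply: (evenZ i [set v | t <= `|v|]) => // v /=.
  by rewrite normrN.
have half := max_tail_ge_half mZ iZ Zp np.
(* Otherwise the same maximum would exceed [t] with probability at least 1/2 and at most 1/6. *)
have tM : t <= 80 * (K * m).
  rewrite leNgt; apply/negP => Mt.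
  have := max_tail_le mXs mZ (fun i => symmetric_same_distribution (lawXs i) hsym)
    (fun i => symmetric_same_distribution (lawZ i) (symmetrized_symmetric PY mY))
    (mutually_independent_upto n indXs) iZ ZX dx (mulr_ge0 (ltW hK) m0) _ ball
    sepS ZS Mt.
  have : forall k, (0 < k)%N ->
    ('N[PS]_(ln (k + 2)%:R)%:E [(fun w => (x k (first_vectors Xs n w))%:E)] <=
     (K * m)%:E)%E.
    by move=> k k0; apply: le_trans (xK k k0) _; rewrite normE -/M mE.
  move=> h /(_ h) /(le_trans half); rewrite lee_fin; lra.
have rM : r <= alpha * m.
  rewrite /r -mulrA; apply: ler_wpM2l; first exact: ltW.
  by rewrite ler_pdivrMr ?mulr_gt0//; lra.
have nq : beta <= n%:R * q.
  rewrite -lee_fin; apply: le_trans (hmax n n0) _; rewrite -/M mE.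
  have mtXs s i : measurable [set w | s <= `|Xs i w|].
    by rewrite -[X in measurable X]setTI; exact: (mXs i measurableT _ (mnorm_ge s)).
  rewrite (_ : [set _ | _] =
      \big[setU/set0]_(i < n) [set w | alpha * m <= `|Xs i w|]).
    apply: (le_trans (Boole_inequality PS
      (A := fun i => [set w | alpha * m <= `|Xs i w|]) _)) => //.
    apply: (@le_trans _ _ (\sum_(i < n) q%:E)%E).
      apply: lee_sum => i _.
      rewrite -qE -[leRHS](lawXs i [set v | r <= `|v|])//.
      apply: le_measure; rewrite ?inE//; first exact: (mtXs r).
      by move=> w; exact: le_trans.
    by rewrite sumEFin sumr_const card_ord mulr_natl.
  rewrite -(bigcup_mkord n (fun i => [set w | alpha * m <= `|Xs i w|])).
  apply/seteqP; split => w /=; rewrite -EFinM lee_fin.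
    (* The default value 0 of the maximum does not reach the threshold, since
       [alpha * m >= r > 0]. *)
    move=> rmax; apply: contrapT => nU; move: rmax; apply/negP; rewrite -ltNge.
    apply/bigmax_ltP; split => [|i _]; first exact: lt_le_trans rM.
    by rewrite ltNge; apply/negP => ri; apply: nU; exists i => //=.
  move=> [i /= ni] /le_trans; apply.
  exact: (le_bigmax _ (fun i : 'I_n => `|Xs i w|) (Ordinal ni)).
(* Here [p * beta <= p * n * q], and [n * p <= 2] is the source of the factor 2. *)
have : p * beta <= 2 * q.
  apply: (@le_trans _ _ (p * (n%:R * q))); first by rewrite ler_wpM2l.
  by rewrite mulrA (mulrC p) ler_wpM2r.
by rewrite mulrAC ler_pdivlMr.
Qed.
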